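(* Let $B$ be a Polish metric space and let $\mathcal{X}=(X,d_X,\pi_X,\mu_X)$ and $\mathcal{Y}=(Y,d_Y,\pi_Y,\mu_Y)$ be $mm$-fields over $B$ such that $\mu_X$ and $\mu_Y$ are fully supported. Then $\mathcal{X}\simeq\mathcal{Y}$ if and only if $\mathcal{D}_{\mathcal{X}}=\mathcal{D}_{\mathcal{Y}}$.
   Context: A Polish metric space is a complete separable metric space. An $mm$-field over a Polish metric space $(B,d_B)$ is a quadruple $\mathcal{X}=(X,d_X,\pi_X,\mu_X)$, where $(X,d_X)$ is a Polish metric space, $\pi_X\colon X\to B$ is 1-Lipschitz and $\mu_X$ is a Borel probability measure on $X$. The measure is fully supported if $\mathrm{supp}\,\mu_X=X$. We write $\mathcal{X}\simeq\mathcal{Y}$ (isomorphic) if there is a bijective isometry $\phi\colon X\to Y$ with $\pi_Y\circ\phi=\pi_X$ and $\phi_*(\mu_X)=\mu_Y$. Let $\mathcal{R}=\{(r_{ij})\in\mathbb{R}^{\mathbb{N}\times\mathbb{N}}: r_{ij}=r_{ji},\ r_{ii}=0,\ r_{ik}\le r_{ij}+r_{jk}\}$ with the weak topology, i.e. the coarsest topology making all projections onto the northwest $n\times n$ blocks continuous, and let $\mathcal{R}_B=\mathcal{R}\times B^\infty$ with the product topology (the space of augmented distance matrices). The augmented distance matrix distribution of $\mathcal{X}$ is the Borel probability measure $\mathcal{D}_{\mathcal{X}}=(\mathcal{F}_{\mathcal{X}})_*(\mu_X^\infty)$ on $\mathcal{R}_B$, where $\mathcal{F}_{\mathcal{X}}\colon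 X^\infty\to\mathcal{R}_B$ is $(x_i)\mapsto((d_X(x_i,x_j))_{ij},(\pi_X(x_i))_i)$ and $\mu_X^\infty$ is the product measure on $X^\infty$. *)

(* Defs.v *)
From HB Require Import structures.
From mathcomp Require Import all_boot all_order all_algebra.
From mathcomp Require Import lra.
From mathcomp Require Import all_classical all_reals all_analysis.
Set Implicit Arguments.
Unset Strict Implicit.
Unset Printing Implicit Defensive.
Import Order.TTheory GRing.Theory Num.Theory.
Import numFieldNormedType.Exports.
Local Open Scope classical_set_scope.
Local Open Scope ring_scope.

HB.mixin Record isSeparable T & Topological T := {
  separable_subproof : exists D : set T, countable D /\ dense D
}.

(* [Complete] is only available for pointed types. This loses nothing here:
   a space carrying a probability measure is not empty, nor is the target of a
   map defined on such a space. *)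
#[short(type="polishMetricType")]
HB.structure Definition PolishMetric (R : realType) :=
  {T of Complete T & Metric R T & isSeparable T}.

(* The countable power T^oo, with the product topology, is {ptws nat -> T}. *)
HB.instance Definition _ (T : ptopologicalType) :=
  Pointed.copy {ptws nat -> T} (nat -> T).
HB.instance Definition _ (T U : ptopologicalType) := Pointed.on (T * U)%type.

Notation borel T := (g_sigma_algebraType (@open T)).

Lemma continuous_borel_measurable (T U : ptopologicalType) (f : T -> U) :
  continuous f -> measurable_fun [set: borel T] (f : borel T -> borel U).
Proof.
move=> /continuousP cf; apply: (@measurability _ _ (borel T) (borel U) _ _ open) => //.
by move=> _ [A oA <-]; rewrite setTI; apply: sub_sigma_algebra; exact: cf.
Qed.

Lemma mdist_continuous (R : realType) (T : metricType R) :
  continuous (fun xy : T * T => mdist xy.1 xy.2).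
Proof.
move=> [x y]; apply/cvgrPdist_lt => e e0 /=.
have e2 : 0 < e / 2 by rewrite divr_gt0.
exists (ball x (e / 2), ball y (e / 2)) => /=.
  by split; exact: nbhsx_ballx.
move=> [x' y'] /= [xx' yy']; rewrite !ballEmdist /= in xx' yy'.
have := metric_triangle x x' y; have := metric_triangle x' y' y.
have := metric_triangle x' x y'; have := metric_triangle x y y'.
rewrite (metric_sym x' x) (metric_sym y' y) => h1 h2 h3 h4.
by rewrite ltr_norml; apply/andP; split; lra.
Qed.

Lemma continuous_sup_initial (S : topologicalType) (T : choiceType) (I : Type)
    (V : I -> topologicalType) (w : forall i, T -> V i)
    (f : S -> sup_topology (fun i => Topological.class (initial_topology (w i)))) :
  (forall i, continuous (w i \o f)) -> continuous f.
Proof.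
move=> cf x; apply/cvg_sup => i.
exact: (@continuous_comp_initial T S (V i) (w i) f (cf i) x).
Qed.

Lemma continuous_mx (S T : topologicalType) m n (f : S -> 'M[T]_(m, n)) :
  (forall i j, continuous (fun x => f x i j)) -> continuous f.
Proof.
move=> cf x A [P nP PA]; rewrite nbhs_simpl /=.
suff : nbhs x [set y | forall i j, P i j (f y i j)].
  by apply: filterS => y Py; exact: PA.
by apply: filter_forall => i; apply: filter_forall => j; exact: cf (nP i j).
Qed.

Section distance_matrices.
Variable R : realType.

Record distMatrix := DistMatrix {
  dmat :> nat -> nat -> R ;
  dmat_sym : forall i j, dmat i j = dmat j i ;
  dmat_diag : forall i, dmat i i = 0 ;
  dmat_triangle : forall i j k, dmat i k <= dmat i j + dmat j k }.

Let dmat0 : distMatrix.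
Proof. by exists (fun _ _ => 0) => // *; rewrite addr0. Defined.

HB.instance Definition _ := gen_eqMixin distMatrix.
HB.instance Definition _ := gen_choiceMixin distMatrix.
HB.instance Definition _ := isPointed.Build distMatrix dmat0.

Definition nwblock n (r : distMatrix) : 'M[R]_n := \matrix_(i, j) r i j.

(* The coarsest topology making all the maps [nwblock n] continuous. *)
HB.instance Definition _ := Topological.copy distMatrix
  (sup_topology (fun n => Topological.class (initial_topology (@nwblock n)))).

End distance_matrices.

Notation augDistMatrix R B := (distMatrix R * {ptws nat -> B})%type.

Section power_measure.
Variables (R : realType) (X : polishMetricType R).
Local Open Scope ereal_scope.

Definition is_power_measure (mu : probability (borel X) R)
    (P : probability (borel {ptws nat -> X}) R) :=
  forall (n : nat) (A : nat -> set (borel X)), (forall i, measurable (A i)) ->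
    P [set x | forall i, (i < n)%N -> A i (x i)] = \prod_(i < n) mu (A i).

(* The product measure mu^oo. A probability measure satisfying
   [is_power_measure mu] exists (Kolmogorov extension) and is unique: X being
   second countable, the sets in [is_power_measure] form a pi-system generating
   the Borel sigma-algebra of X^oo. *)
Definition power_measure (mu : probability (borel X) R) :
  probability (borel {ptws nat -> X}) R := get (is_power_measure mu).

Definition supp (mu : probability (borel X) R) : set X :=
  [set x | forall U : set X, open U -> U x -> 0 < mu U].

End power_measure.
Arguments supp {R X} mu.

Section mm_fields.
Variables (R : realType) (B : polishMetricType R).

Record mmField := MMField {
  mm_space :> polishMetricType R ;
  mm_proj : mm_space -> B ;
  mm_proj_lip : forall x y, mdist (mm_proj x) (mm_proj y) <= mdist x y ;
  mm_measure : probability (borel mm_space) R }.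

(* Isomorphism of mm-fields; mu_Y is only required to agree with the
   pushforward of mu_X on Borel sets, as measures are total functions whose
   values on other sets are irrelevant. *)
Definition mm_iso (X Y : mmField) := exists phi : X -> Y,
  [/\ bijective phi,
      forall x x', mdist (phi x) (phi x') = mdist x x',
      forall x, mm_proj (phi x) = mm_proj x &
      forall A : set (borel Y), measurable A ->
        pushforward (mm_measure X) (phi : borel X -> borel Y) A =
        mm_measure Y A].

Variable X : mmField.

Definition seq_dmat (x : nat -> X) : distMatrix R :=
  DistMatrix (fun i j => metric_sym (x i) (x j))
             (fun i => mdistxx (x i))
             (fun i j k => metric_triangle (x i) (x j) (x k)).

(* The map F_X : X^oo -> R_B. *)
Definition aug_dmat (x : {ptws nat -> X}) : augDistMatrix R B :=
  (seq_dmat x, fun i => mm_proj (x i)).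

Lemma seq_dmat_continuous : continuous (seq_dmat : {ptws nat -> X} -> distMatrix R).
Proof.
have projX i : continuous (fun x : {ptws nat -> X} => x i).
  exact: (@proj_continuous nat (fun=> X) i).
apply: (@continuous_sup_initial {ptws nat -> X} (distMatrix R) nat
  (fun n => 'M[R]_n) (fun n => @nwblock R n) seq_dmat) => n.
apply: (@continuous_mx _ R) => i j.
rewrite (_ : (fun _ => _) = (fun y : {ptws nat -> X} => mdist (y i) (y j))).
  move=> x; exact: continuous2_cvg (@mdist_continuous R X (x i, x j))
    (projX i x) (projX j x).
by apply/funext => y; rewrite /= mxE.
Qed.

Lemma map_proj_continuous :
  continuous (fun x : {ptws nat -> X} => (fun i => mm_proj (x i)) : {ptws nat -> B}).
Proof.
have projX i : continuous (fun x : {ptws nat -> X} => x i).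
  exact: (@proj_continuous nat (fun=> X) i).
apply: (@continuous_sup_initial {ptws nat -> X} (nat -> B) nat
  (fun=> B) (fun i f => f i) (fun x i => mm_proj (x i))) => i.
move=> x; apply: (@cvg_comp _ _ _ (fun y : {ptws nat -> X} => y i) (@mm_proj X) _ _ _ (projX i x)).
apply/cvg_ballP => e e0; near=> y; rewrite ballEmdist /=.
apply: le_lt_trans (mm_proj_lip _ _) _.
have : ball (x i) e y by near: y; exact: nbhsx_ballx.
by rewrite ballEmdist.
Unshelve. all: by end_near. Qed.

Lemma aug_dmat_continuous : continuous aug_dmat.
Proof.
move=> x.
exact: (cvg_pair (@seq_dmat_continuous x) (@map_proj_continuous x)).
Qed.

Lemma aug_dmat_measurable :
  measurable_fun setT (aug_dmat : borel {ptws nat -> X} -> borel (augDistMatrix R B)).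
Proof.
exact: (@continuous_borel_measurable {ptws nat -> X} (augDistMatrix R B) _
  aug_dmat_continuous).
Qed.

Definition aug_dmat_mfun :
    {mfun borel {ptws nat -> X} >-> borel (augDistMatrix R B)} :=
  HB.pack_for {mfun borel {ptws nat -> X} >-> borel (augDistMatrix R B)}
    (aug_dmat : borel {ptws nat -> X} -> borel (augDistMatrix R B))
    (@isMeasurableFun.Build _ _ (borel {ptws nat -> X})
      (borel (augDistMatrix R B)) aug_dmat aug_dmat_measurable).

Definition aug_dmat_distr : probability (borel (augDistMatrix R B)) R :=
  distribution (power_measure (mm_measure X)) aug_dmat_mfun.

End mm_fields.

(* Main.v *)
Require Import Defs.
From HB Require Import structures.
From mathcomp Require Import all_boot all_order all_algebra.
From mathcomp Require Import ring lra zify.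
From mathcomp Require Import all_classical all_reals all_analysis measurable_realfun.

(** The isomorphism type of a fully supported mm-field is recovered from the
distances and labels of an i.i.d. sequence of points, because such a sequence
[x] is almost surely equidistributed: for every list of balls centred at points
of the sequence, the measure of their intersection can be read off from the
matrix of distances [mdist (x i) (x j)], as a limit of empirical frequencies.

Given two fields with the same distribution, it is enough to find sequences [x]
in [X] and [y] in [Y], both equidistributed, with the same augmented distance
matrix.  Full support makes [x] and [y] dense ([equidistributed_dense]), so that
[x i |-> y i] extends to a bijective isometry of the complete spaces
([extend_isometry]), which respects the labels by continuity.  It carries finite
intersections of balls centred at the [x i] to those centred at the [y i], and
these have equal measures ([equidistributed_cell]); as they form a pi-system
generating the Borel sets ([open_cell_gen]), the isometry preserves the measure.

The set of equidistributed sequences has measure 1, but its image in the space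
of augmented matrices need not be Borel, so two sets of full measure cannot
simply be intersected there.  Instead, [x] is confined to a compact set of
measure more than 1/2; its image is then compact, hence Borel, and two Borel sets
of probability more than 1/2 meet ([common_aug_dmat]).  The compact set is the
intersection of a product of compact sets ([power_measure_tight]) with a closed
set of sequences along which the weak law of large numbers holds at an explicit
rate ([typical]).  Closedness is the reason for using continuous test functions,
the tents, in place of indicators; and the rate makes the empirical means
converge along a sequence of sample sizes that is the same for both fields.

For this the product measure [power_measure] must be known to exist
([power_measureP]): finite products define an additive content on cylinder sets,
which is sigma-additive since a decreasing sequence of cylinders with empty
intersection has content tending to 0 ([cylinder_compactness]), and the
Caratheodory extension applies.  Uniqueness of that measure
([is_power_measure_unique]) gives the converse implication: an isomorphism maps
one product measure to the other ([power_measure_pushforward]). *)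

Set Implicit Arguments.
Unset Strict Implicit.
Unset Printing Implicit Defensive.
Import Order.TTheory GRing.Theory Num.Theory.
Import numFieldNormedType.Exports.
Local Open Scope classical_set_scope.
Local Open Scope ring_scope.

(** * Polish spaces and their countable powers *)

Lemma closed_borel (T : ptopologicalType) (A : set T) :
  closed A -> measurable (A : set (borel T)).
Proof.
move=> cA; rewrite -[A]setCK; apply: measurableC; apply: sub_sigma_algebra.
exact: closed_openC.
Qed.

Section polish.
Variables (R : realType) (X : polishMetricType R).

Lemma exists_dense_seq : exists a : nat -> X,
  forall x e, 0 < e -> exists n, mdist x (a n) < e.
Proof.
have [D [cD dD]] := @separable_subproof R X.
have D0 : D !=set0.
  by have [x [_ Dx]] := dD setT (ex_intro _ point I) openT; exists x.
have /pfcard_geP [D00|[f]] := cD; first by rewrite D00 in D0; case: D0.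
exists f => x e e0.
have [y [bxy Dy]] : ball x e `&` D !=set0.
  have [y [By Dy]] := dD (ball x e)° (ex_intro _ x (nbhsx_ballx x e e0))
    (open_interior _).
  by exists y; split => //; exact: interior_subset.
have [n _ fn] := @surj _ _ _ _ f _ Dy.
by exists n; rewrite fn; move: bxy; rewrite ballEmdist.
Qed.

Lemma nbhs_mdist (x : X) (W : set X) : nbhs x W ->
  exists2 e, 0 < e & forall y, mdist x y < e -> W y.
Proof.
move=> /nbhs_ballP[e /= e0 eW]; exists e => // y xy; apply: eW.
by rewrite ballEmdist.
Qed.

Lemma mdist_nbhs (x : X) e : 0 < e -> nbhs x [set y | mdist x y < e].
Proof. by move=> e0; rewrite -ballEmdist; exact: nbhsx_ballx. Qed.

Lemma mdist_lip (x y z : X) : `|mdist x z - mdist y z| <= mdist x y.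
Proof.
have := metric_triangle x y z; have := metric_triangle y x z.
by rewrite (metric_sym y x) ler_norml => h1 h2; apply/andP; split; lra.
Qed.

Lemma open_mball (x : X) e : open [set y | mdist x y < e].
Proof.
rewrite openE => y /= xy; apply/nbhs_ballP.
exists (e - mdist x y); first by rewrite /= subr_gt0.
move=> z; rewrite ballEmdist /= => yz.
by apply: le_lt_trans (metric_triangle x y z) _; rewrite -ltrBrDl.
Qed.

Lemma closed_mball (x : X) e : closed [set y | mdist x y <= e].
Proof.
rewrite (_ : [set y | _] = ~` [set y | e < mdist x y]); last first.
  by apply/seteqP; split => y /=; [move=> /le_gtF ->|move/negP; rewrite -leNgt].
apply: open_closedC; rewrite openE => y /= xy.
apply/nbhs_ballP; exists (mdist x y - e); first by rewrite /= subr_gt0.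
move=> z; rewrite ballEmdist /= => yz.
by have := metric_triangle x z y; rewrite (metric_sym z y); lra.
Qed.

Lemma exists_invS_lt (e : R) : 0 < e -> exists m, m.+1%:R^-1 < e.
Proof.
move=> e0; exists (Num.truncn e^-1).
by rewrite -[ltRHS]invrK ltf_pV2 ?posrE ?ltr0n ?invr_gt0// truncnS_gt.
Qed.

(** The boxes on the right form a filter that converges to [x] in every
coordinate, hence in the product topology, so each neighbourhood of [x] contains
one of them.  Using the same number for the width and for how many coordinates
are constrained makes the boxes a countable family. *)
Lemma nbhs_ptws (x : {ptws nat -> X}) (W : set {ptws nat -> X}) : nbhs x W ->
  exists N, [set y | forall i, (i < N)%N -> mdist (x i) (y i) < N.+1%:R^-1] `<=` W.
Proof.
move=> xW.
pose U N := [set y : {ptws nat -> X} |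
  forall i, (i < N)%N -> mdist (x i) (y i) < N.+1%:R^-1].
pose F := filter_from [set: nat] U.
have FF : Filter F.
  apply: filter_from_filter; first by exists 0%N.
  move=> i j _ _; exists (maxn i j) => // y Uy; split => k kij;
    (apply: lt_le_trans (Uy k _) _; first by rewrite leq_max kij ?orbT);
    by rewrite lef_pV2 ?posrE ?ltr0n// ler_nat ltnS leq_max leqnn ?orbT.
suff : F --> x by move=> /(_ _ xW) [N _ NW]; exists N.
apply/cvg_sup => i.
apply/cvg_image.
  rewrite eqEsubset; split => // z _; exists (fun=> z) => //.
move=> A /nbhs_mdist [e e0 eA].
have [N Ne] := exists_invS_lt e0.
exists [set y : {ptws nat -> X} | A (y i)]; last first.
  rewrite eqEsubset; split => [_ [y Ay <-]//|z Az].
  by exists (fun=> z).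
exists (maxn i.+1 N) => // y Uy; apply: eA; apply: lt_trans Ne.
apply: lt_le_trans (Uy _ _) _; first by rewrite leq_max ltnSn.
by rewrite lef_pV2 ?posrE ?ltr0n// ler_nat ltnS leq_max leqnn orbT.
Qed.

End polish.

Section sequences.
Variables (R : realType) (X : polishMetricType R).

Definition coord_sets : set (set {ptws nat -> X}) :=
  [set C | exists i (U : set X), open U /\ C = [set x | U (x i)]].

Lemma ptws_coord_continuous i : continuous (fun x : {ptws nat -> X} => x i).
Proof. exact: (@proj_continuous nat (fun=> X) i). Qed.

(** Boxes with finitely many sides centred at a dense sequence form a countable
base of the product topology: this is where separability makes the Borel
sigma-algebra of the power no larger than the product sigma-algebra. *)
Lemma open_ptws_gen (W : set {ptws nat -> X}) : open W -> <<s coord_sets >> W.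
Proof.
move=> oW; have [a adense] := exists_dense_seq X.
pose C (c : seq nat * nat) : set {ptws nat -> X} :=
  [set y | forall i, (i < c.2)%N ->
     mdist (a (nth 0%N c.1 i)) (y i) < c.2.+1%:R^-1].
have mC c : <<s coord_sets >> (C c).
  rewrite (_ : C c = \bigcap_(i < c.2) [set y : {ptws nat -> X} |
      mdist (a (nth 0%N c.1 i)) (y i) < c.2.+1%:R^-1]); last first.
    by rewrite eqEsubset; split => y Cy i /= ic; exact: Cy.
  apply: (@fin_bigcap_measurable _ (g_sigma_algebraType coord_sets)) => // i _.
  apply: sub_sigma_algebra.
  exists i, [set z | mdist (a (nth 0%N c.1 i)) z < c.2.+1%:R^-1].
  by split => //; exact: open_mball.
pose code n : seq nat * nat := odflt ([::], 0%N) (unpickle n).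
rewrite (_ : W = \bigcup_(n in [set n | C (code n) `<=` W]) C (code n)).
  apply: (@bigcup_measurable _ (g_sigma_algebraType coord_sets)) => n _.
  exact: mC.
apply/seteqP; split => [x Wx|x [n /= nW nx]]; last exact: nW.
have [N NW] := nbhs_ptws (open_nbhs_nbhs (conj oW Wx)).
(* Centres within 1 / M.+1 of the x i put x in the box, and every point of the
   box within 2 / M.+1 <= 1 / N.+1 of x in each of the first N coordinates. *)
pose M := (2 * N.+1)%N.
have M0 : 0 < (M.+1%:R^-1 : R) by rewrite invr_gt0.
pose s := [seq xget 0%N [set n | mdist (x i) (a n) < M.+1%:R^-1] | i <- iota 0 M].
have sE i : (i < M)%N -> mdist (x i) (a (nth 0%N s i)) < M.+1%:R^-1.
  move=> iM; rewrite (nth_map 0%N) ?size_iota// nth_iota// add0n.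
  by case: xgetP => [n _ //|/(_ _)]; have [n nP] := adense (x i) _ M0 => /(_ n).
have codeE : code (pickle (s, M)) = (s, M) by rewrite /code pickleK.
exists (pickle (s, M)); rewrite /mkset codeE.
  move=> y Cy; apply: NW => i iN.
  have iM : (i < M)%N by move: iN; rewrite /M; lia.
  apply: le_lt_trans (metric_triangle _ (a (nth 0%N s i)) _) _.
  have h : 2 * M.+1%:R^-1 <= N.+1%:R^-1 :> R.
    rewrite ler_pdivrMr ?ltr0n// mulrC ler_pdivlMr ?ltr0n//.
    by rewrite -natrM ler_nat /M; lia.
  apply: lt_le_trans h; rewrite mulr_natl mulr2n.
  by apply: ltrD; [exact: sE|exact: Cy].
by move=> i iM; rewrite metric_sym; exact: sE.
Qed.

Lemma coord_measurable i :
  measurable_fun setT ((fun x => x i) : borel {ptws nat -> X} -> borel X).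
Proof.
exact: (@continuous_borel_measurable {ptws nat -> X} X _ (@ptws_coord_continuous i)).
Qed.

Lemma borel_ptwsE : @measurable _ (borel {ptws nat -> X}) = <<s coord_sets >>.
Proof.
rewrite eqEsubset; split => A.
  apply: smallest_sub; first exact: smallest_sigma_algebra.
  exact: open_ptws_gen.
apply: smallest_sub; first exact: smallest_sigma_algebra.
move=> _ [i [U [oU ->]]]; apply: sub_sigma_algebra.
by apply: open_comp => // x _; exact: ptws_coord_continuous.
Qed.

Lemma measurable_fun_ptws d (T : measurableType d) (f : T -> borel {ptws nat -> X}) :
  (forall i, measurable_fun setT (fun t => f t i : borel X)) ->
  measurable_fun setT f.
Proof.
move=> mf; apply: (@measurability _ _ T (borel {ptws nat -> X}) _ _ coord_sets) => //.
  exact: borel_ptwsE.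
move=> _ [_ [i [U [oU ->]]] <-].
by apply: mf => //; exact: sub_sigma_algebra.
Qed.

Lemma measurable_rectangle n (A : nat -> set (borel X)) :
  (forall i, measurable (A i)) ->
  measurable ([set x | forall i, (i < n)%N -> A i (x i)] : set (borel {ptws nat -> X})).
Proof.
move=> mA.
rewrite (_ : [set x | _] = \bigcap_(i < n) [set x | A i (x i)]); last first.
  by rewrite eqEsubset; split => y Cy i /= ic; exact: Cy.
apply: fin_bigcap_measurable => // i _.
by rewrite -[X in measurable X]setTI; exact: coord_measurable.
Qed.

(** Finite-dimensional rectangles form a pi-system that generates the Borel
sets. *)
Lemma is_power_measure_unique (mu : probability (borel X) R)
    (P Q : probability (borel {ptws nat -> X}) R) :
  is_power_measure mu P -> is_power_measure mu Q ->
  forall A : set (borel {ptws nat -> X}), measurable A -> P A = Q A.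
Proof.
move=> HP HQ.
pose G : set (set (borel {ptws nat -> X})) := [set C | exists n (A : nat -> set (borel X)),
  (forall i, measurable (A i)) /\ C = [set x | forall i, (i < n)%N -> A i (x i)]].
move=> A mA.
apply: (@g_sigma_algebra_measure_unique _ R (borel {ptws nat -> X}) G _ (fun=> setT)).
- by move=> _ [n [B [mB ->]]]; exact: measurable_rectangle.
- move=> i; exists 0%N, (fun=> setT); split => //.
  by apply/seteqP; split.
- by rewrite bigcup_const//; exists 0%N.
- move=> _ _ [n [B [mB ->]]] [m [C [mC ->]]].
  exists (maxn n m), (fun i => (if (i < n)%N then B i else setT) `&`
     (if (i < m)%N then C i else setT)); split.
    by move=> i; apply: measurableI; case: ifP.
  apply/seteqP; split => [x [Bx Cx] i _|x ABx].
    by split; case: ifPn => // im; [exact: Bx|exact: Cx].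
  split => i im.
    by have [] := ABx i; rewrite ?leq_max im// orbT.
  by have [] := ABx i; rewrite ?leq_max im ?orbT.
- move=> _ [n [B [mB ->]]]; exact: etrans (HP n B mB) (esym (HQ n B mB)).
- by move=> k; rewrite (le_lt_trans (probability_le1 _ _))// ltry.
- move: A mA; rewrite borel_ptwsE; apply: smallest_sub; first exact: smallest_sigma_algebra.
  move=> _ [i [U [oU ->]]]; apply: sub_sigma_algebra.
  exists i.+1, (fun j => if j == i then U else setT); split.
    by move=> j; case: ifP => // _; exact: sub_sigma_algebra.
  apply/seteqP; split => [x Ux j _|x /(_ i (ltnSn i))]; last by rewrite eqxx.
  by case: eqP => // ->.
Qed.

End sequences.

(** * Existence of countable product measures *)

Definition mfun_of d d' (T : measurableType d) (T' : measurableType d')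
    (f : T -> T') (mf : measurable_fun setT f) : {mfun T >-> T'} :=
  HB.pack_for {mfun T >-> T'} f (@isMeasurableFun.Build _ _ T T' f mf).

Section power_measure_existence.
Variables (R : realType) (X : polishMetricType R).
Variable mu : probability (borel X) R.
Local Open Scope ereal_scope.
Let S := borel {ptws nat -> X}.

Definition scons (p : borel X * S) : S :=
  fun n => if n is k.+1 then p.2 k else p.1.

Lemma measurable_scons : measurable_fun setT scons.
Proof.
apply: measurable_fun_ptws => -[|k]; first exact: measurable_fst.
exact: measurableT_comp (@coord_measurable R X k) measurable_snd.
Qed.

(** The law of a sequence whose first [n] terms are independent with law [mu],
all later terms being equal to the default point.  Placing the finite products
on the space of sequences lets one recursion on [scons] handle them all. *)
Fixpoint fin_power (n : nat) : probability S R :=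
  if n is m.+1 then
    distribution (mu \x fin_power m : probability (borel X * S)%type R)
      (mfun_of measurable_scons)
  else dirac (point : S).

Definition slice (x : borel X) (C : set S) : set S := [set s | C (scons (x, s))].

Lemma measurable_slice x (C : set S) : measurable C -> measurable (slice x C).
Proof.
move=> mC; have : measurable (scons @^-1` C).
  by rewrite -[X in measurable X]setTI; exact: measurable_scons.
by move=> /(measurable_xsection x); rewrite /xsection; congr measurable;
  apply/seteqP; split => s /=; rewrite in_setE.
Qed.

Lemma fin_power_sliceE n (C : set S) :
  (fun x => fin_power n (slice x C)) = fin_power n \o xsection (scons @^-1` C).
Proof.
apply/funext => x /=; congr (fin_power n _).
by apply/seteqP; split => s /=; rewrite /xsection /= in_setE.
Qed.

Lemma fin_powerS n (C : set S) :
  fin_power n.+1 C = \int[mu]_x fin_power n (slice x C).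
Proof.
by rewrite fin_power_sliceE.
Qed.

Lemma measurable_fin_power_slice n (C : set S) : measurable C ->
  measurable_fun setT ((fun x => fin_power n (slice x C)) : borel X -> \bar R).
Proof.
move=> mC; rewrite fin_power_sliceE; apply: measurable_fun_xsection.
by rewrite -[X in measurable X]setTI; exact: measurable_scons.
Qed.

Definition depends_on (n : nat) (C : set S) :=
  forall s t : S, (forall i, (i < n)%N -> s i = t i) -> C s -> C t.

Lemma depends_on_le m n C : (m <= n)%N -> depends_on m C -> depends_on n C.
Proof.
by move=> mn dC s t st; apply: dC => i im; apply: st; exact: leq_trans mn.
Qed.

Lemma depends_on_slice n C x : depends_on n.+1 C -> depends_on n (slice x C).
Proof. by move=> dC s t st; apply: dC => -[|i]//=; exact: st. Qed.

Lemma depends_on0 C : depends_on 0 C -> C = set0 \/ C = setT.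
Proof.
move=> dC; have [[s Cs]|] := pselect (exists s, C s).
  by right; apply/seteqP; split => // t _; exact: dC Cs.
by move=> C0; left; apply/seteqP; split => // t Ct; exfalso; apply: C0; exists t.
Qed.

(** Consistency of the finite products: terms on which [C] does not depend
may be chosen in any way. *)
Lemma fin_power_stable n k C : depends_on n C -> fin_power (n + k) C = fin_power n C.
Proof.
elim: n C => [|n IH] C dC; last first.
  rewrite addSn !fin_powerS; apply: eq_integral => x _.
  by rewrite IH//; exact: depends_on_slice.
by have [->|->] := depends_on0 dC; rewrite ?measure0// !probability_setT.
Qed.

Definition cylinder (C : set S) := measurable C /\ exists n, depends_on n C.

(** The number of coordinates is chosen arbitrarily among those on which [C]
depends; by consistency the choice is immaterial. *)
Definition cyl_content (C : set S) := fin_power (xget 0%N [set n | depends_on n C]) C.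

Lemma cyl_contentE n C : depends_on n C -> cyl_content C = fin_power n C.
Proof.
rewrite /cyl_content; case: xgetP => [m _ dm dn|+ dn]; last by move=> /(_ n).
by have [/subnKC<-|/ltnW/subnKC<-] := leqP m n; rewrite fin_power_stable.
Qed.

Lemma cylinder0 : cylinder set0.
Proof. by split => //; exists 0%N. Qed.

Lemma cylinderC C : cylinder C -> cylinder (~` C).
Proof.
move=> [mC [n dC]]; split; first exact: measurableC.
by exists n => s t st nCs Ct; apply: nCs; apply: dC Ct => i /st.
Qed.

Lemma cylinderU C D : cylinder C -> cylinder D -> cylinder (C `|` D).
Proof.
move=> [mC [n dC]] [mD [m dD]]; split; first exact: measurableU.
exists (maxn n m) => s t st [Cs|Ds]; [left; apply: dC Cs|right; apply: dD Ds];
  by move=> i im; apply: st; rewrite leq_max im ?orbT.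
Qed.

Lemma cylinder_slice C x : cylinder C -> cylinder (slice x C).
Proof.
move=> [mC [n dC]]; split; first exact: measurable_slice.
by exists n; apply: depends_on_slice; exact: depends_on_le dC.
Qed.

(** Fubini for the content: it is obtained by drawing the first coordinate and
then the content of the slice. *)
Lemma cyl_content_slice C : cylinder C ->
  measurable_fun setT ((fun x => cyl_content (slice x C)) : borel X -> \bar R) /\
  cyl_content C = \int[mu]_x cyl_content (slice x C).
Proof.
move=> [mC [n dC]].
have dC' : depends_on n.+1 C by exact: depends_on_le dC.
have E : (fun x => cyl_content (slice x C)) = (fun x => fin_power n (slice x C)).
  by apply/funext => x; apply: cyl_contentE; exact: depends_on_slice.
rewrite E; split; first exact: measurable_fin_power_slice.
by rewrite (cyl_contentE dC') fin_powerS.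
Qed.

Lemma cyl_content_ge0 C : 0 <= cyl_content C.
Proof. exact: measure_ge0. Qed.

Lemma cyl_content_le1 C : cylinder C -> cyl_content C <= 1.
Proof. by move=> [mC _]; exact: probability_le1. Qed.

(** By dominated convergence.  Read contrapositively: if the contents do not
tend to 0, there is a first coordinate for which those of the slices do not
either. *)
Lemma cyl_content_slice_cvg0 (C : nat -> set S) : (forall k, cylinder (C k)) ->
  (forall x, cyl_content (slice x (C k)) @[k --> \oo] --> 0) ->
  cyl_content (C k) @[k --> \oo] --> 0.
Proof.
move=> cC C0.
have -> : (fun k => cyl_content (C k)) =
    (fun k => \int[mu]_x cyl_content (slice x (C k))).
  by apply/funext => k; exact: (cyl_content_slice (cC k)).2.
have [] := @dominated_convergence _ (borel X) R mu setT measurableT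
  (fun k x => cyl_content (slice x (C k))) (cst 0) (cst 1).
- by move=> k; exact: (cyl_content_slice (cC k)).1.
- exact: measurable_cst.
- by apply: aeW => x _; exact: C0.
- exact: (finite_measure_integrable_cst mu 1%R).
- apply: aeW => x n _; rewrite gee0_abs ?cyl_content_ge0//.
  by apply: cyl_content_le1; exact: cylinder_slice.
by rewrite integral0.
Qed.

Let vanishing (C : nat -> set S) := cyl_content (C k) @[k --> \oo] --> 0.

(** If the contents did not tend to 0, first coordinates could be chosen one
after the other so that the contents of the successive slices never tend to 0.
The resulting sequence lies in every [C k]: once the coordinates on which [C k]
depends are fixed, the slice of [C k] is empty or full, and if it were empty the
later slices would be empty too, with content 0. *)
Lemma cylinder_compactness (C : nat -> set S) : (forall k, cylinder (C k)) ->
  nonincreasing_seq C -> \bigcap_k C k = set0 -> vanishing C.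
Proof.
move=> cC dC C0; apply: contrapT => nC.
pose pick (D : nat -> set S) : X :=
  xget point [set x | ~ vanishing (fun k => slice x (D k))].
pose D := fix D n : nat -> set S :=
  if n is m.+1 then fun k => slice (pick (D m)) (D m k) else C.
have cD n k : cylinder (D n k).
  by elim: n k => [//|n IH] k /=; exact: cylinder_slice.
have nD n : ~ vanishing (D n).
  elim: n => [//|n IH] /=; rewrite /pick; case: xgetP => [x _ //|nx].
  exfalso; apply: IH; apply: cyl_content_slice_cvg0 => // x.
  by apply: contrapT; exact: nx.
have dD n j k : (j <= k)%N -> D n k `<=` D n j.
  elim: n j k => [|n IH] j k jk /=; first by apply/subsetPset/dC.
  by move=> s; exact: IH.
pose s : S := fun n => pick (D n).
have DC n k : D n k (fun i => s (n + i)%N) -> C k s.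
  elim: n => [//|n IH] Dn; apply: IH; move: Dn; rewrite /= /slice /=.
  by congr (D n k _); apply/funext => -[|i] /=; rewrite ?addn0// addSnnS.
have : (\bigcap_k C k) s; last by rewrite C0.
move=> k _; apply: contrapT => nCs.
have [_ [m dm]] := cC k.
have dDm : depends_on 0 (D m k).
  have : forall n i, depends_on (n + i) (C k) -> depends_on i (D n k).
    elim => [//|n IH] i; rewrite addSnnS => /IH; exact: depends_on_slice.
  by apply; rewrite addn0.
have {}Dmk : D m k = set0.
  have [//|DT] := depends_on0 dDm.
  by exfalso; apply: nCs; apply: (DC m); rewrite DT.
apply: (nD m); apply: cvg_near_cst; near=> j.
have -> : D m j = set0.
  apply/seteqP; split => // t Dt; rewrite -Dmk.
  by apply: (dD m k j) => //; near: j; exact: nbhs_infty_ge.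
exact: measure0.
Unshelve. all: by end_near. Qed.

(** A separate type, because the cylinders give the space of sequences a second
structure of algebra of sets. *)
Definition cyl_space : Type := S.
HB.instance Definition _ := Pointed.copy cyl_space S.
HB.instance Definition _ := @isAlgebraOfSets.Build default_measure_display
  cyl_space cylinder cylinder0 cylinderU cylinderC.

(** The tails [C n] of the union are cylinders decreasing to the empty set, so
finite additivity passes to the limit. *)
Lemma cyl_content_sigma_additive :
  semi_sigma_additive (cyl_content : set cyl_space -> \bar R).
Proof.
move=> F mF tF mU.
pose C n := \bigcup_i F i `\` \big[setU/set0]_(i < n) F i.
have mB n : measurable (\big[setU/set0]_(i < n) F i) by exact: bigsetU_measurable.
have mC n : cylinder (C n).
  by have : measurable (C n : set cyl_space) by exact: measurableD.
have C0 : vanishing C.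
  apply: cylinder_compactness => //.
    move=> i j ij; apply/subsetPset; apply: setDS; exact: subset_bigsetU.
  apply/seteqP; split => // s Cs.
  have [[i _ Fi] _] := Cs 0%N I.
  have [_] := Cs i.+1 I; apply.
  by rewrite big_ord_recr /=; right.
have addE n : cyl_content (\bigcup_i F i) =
    cyl_content (C n) + \sum_(0 <= i < n) cyl_content (F i).
  have dimP (A : set S) : cylinder A -> exists n, depends_on n A by case.
  have [d dF] : {d : nat -> nat & forall i, depends_on (d i) (F i)}.
    by apply: (@choice _ _ (fun i n => depends_on n (F i))) => i; exact: (mF i).2.
  have [e dU] := dimP _ mU.
  (* All the sets involved depend on the first N coordinates only, so additivity
     of the content is that of the measure fin_power N. *)
  pose N := (e + \sum_(i < n) d i)%N.
  have dUN : depends_on N (\bigcup_i F i) by apply: depends_on_le dU; exact: leq_addr.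
  have dFN (i : 'I_n) : depends_on N (F i).
    by apply: depends_on_le (dF i); rewrite /N (bigD1 i)//= addnCA leq_addr.
  have dBN : depends_on N (\big[setU/set0]_(i < n) F i).
    elim/big_ind: _ => //.
    by move=> A B dA dB s t st [As|Bs]; [left; apply: dA As|right; apply: dB Bs].
  have dCN : depends_on N (C n).
    move=> s t st [Us nBs]; split; first exact: dUN Us.
    by move=> Bt; apply: nBs; apply: dBN Bt => i /st.
  have mFS i : measurable (F i : set S) by case: (mF i).
  rewrite (cyl_contentE dUN) (cyl_contentE dCN) big_mkord.
  rewrite (eq_bigr (fun i : 'I_n => fin_power N (F i))); last first.
    by move=> i _; exact: cyl_contentE.
  rewrite -measure_bigsetU//= -measureU//.
  - by rewrite setUC /C setDUK// => s; rewrite -bigcup_mkord => -[i _ Fi]; exists i.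
  - by case: (mC n).
  - by apply: bigsetU_measurable.
  - by apply/seteqP; split => // s [[]].
have cF0 i : (0 <= cyl_content (F i))%E by exact: cyl_content_ge0.
have -> : (fun n => \sum_(0 <= i < n) cyl_content (F i)) =
    (fun n => cyl_content (\bigcup_i F i) - cyl_content (C n)).
  apply/funext => n; rewrite (addE n) [X in _ = X - _]addeC addeK//.
  by rewrite ge0_fin_numE ?cyl_content_ge0// (le_lt_trans (cyl_content_le1 (mC n)))// ltry.
rewrite -[X in _ --> X]sube0; apply: cvgeB => //; last exact: cvg_cst.
by rewrite fin_num_adde_defl.
Qed.

Definition cyl_measure : set cyl_space -> \bar R := cyl_content.
HB.instance Definition _ := isMeasure.Build default_measure_display cyl_space R
  cyl_measure (measure0 _) cyl_content_ge0 cyl_content_sigma_additive.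

Lemma measurable_cyl_id : measurable_fun setT
  (id : g_sigma_algebraType (@measurable _ cyl_space) -> S).
Proof.
apply: measurable_fun_ptws => i _ A mA; rewrite setTI; apply: sub_sigma_algebra.
split; first by rewrite -[X in measurable X]setTI; exact: coord_measurable.
by exists i.+1 => s t st /=; rewrite st.
Qed.

Lemma power_measure_exists :
  exists P : probability S R, is_power_measure mu P.
Proof.
pose E := measure_extension cyl_measure.
have EE (A : set S) : cylinder A -> E A = cyl_content A.
  exact: (@measurable_mu_extE _ R cyl_space cyl_measure).
have E1 : E setT = 1.
  rewrite EE; last by rewrite -setC0; exact: cylinderC cylinder0.
  exact: probability_setT.
pose Q := HB.pack_for (probability (g_sigma_algebraType (@measurable _ cyl_space)) R) E
  (Measure_isProbability.Build _ _ _ E E1).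
exists (distribution Q (mfun_of measurable_cyl_id)) => n A mA.
rewrite -[LHS]/(E [set x : S | forall i, (i < n)%N -> A i (x i)]).
have dR m (B : nat -> set (borel X)) :
    depends_on m [set x : S | forall i, (i < m)%N -> B i (x i)].
  by move=> s t st Bs i im; rewrite -st//; exact: Bs.
rewrite EE; last by split; [exact: measurable_rectangle|exists n].
rewrite (cyl_contentE (dR _ _)).
elim: n A mA => [|n IH] A mA.
  rewrite big_ord0 (_ : [set _ | _] = setT) ?probability_setT//.
  by apply/seteqP; split.
rewrite big_ord_recl/= -(IH (fun i => A i.+1))//.
rewrite -product_measure1E//; last exact: (@measurable_rectangle _ _ n (fun i => A i.+1)).
rewrite /distribution /pushforward; congr (_ _).
apply/seteqP; split => [[x s] /= As|[x s] /= [A0 As] [|i]//=]; last exact: As.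
by split; [exact: (As 0%N)|move=> i im; exact: (As i.+1)].
Qed.

Lemma power_measureP : is_power_measure mu (power_measure mu).
Proof. by case: power_measure_exists => P HP; exact: getI HP. Qed.

End power_measure_existence.

(** * Isomorphic fields have the same distribution *)

Lemma power_measure_pushforward (R : realType) (X Y : polishMetricType R)
    (mu : probability (borel X) R) (nu : probability (borel Y) R)
    (phi : borel X -> borel Y) (mphi : measurable_fun setT phi) :
  (forall A, measurable A -> mu (phi @^-1` A) = nu A) ->
  forall A : set (borel {ptws nat -> Y}), measurable A ->
    power_measure mu [set x | A (fun i => phi (x i))] = power_measure nu A.
Proof.
move=> mu_nu.
pose Phi : borel {ptws nat -> X} -> borel {ptws nat -> Y} := fun x i => phi (x i).
have mPhi : measurable_fun setT Phi.
  apply: measurable_fun_ptws => i.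
  exact: (measurableT_comp mphi (@coord_measurable R X i)).
apply: (is_power_measure_unique (P := distribution (power_measure mu) (mfun_of mPhi))
  (mu := nu)) => [n A mA|]; last exact: power_measureP.
have mA' i : measurable (phi @^-1` A i : set (borel X)).
  by rewrite -[X in measurable X]setTI; exact: mphi.
apply: etrans (@power_measureP _ _ mu n (fun i => phi @^-1` A i) mA') _.
by apply: eq_bigr => i _; exact: mu_nu.
Qed.

Lemma isometry_continuous (R : realType) (X Y : polishMetricType R) (phi : X -> Y) :
  (forall x x', mdist (phi x) (phi x') = mdist x x') -> continuous phi.
Proof.
move=> iso x W /nbhs_mdist[e e0 eW].
by apply: filterS (mdist_nbhs x e0) => y xy; apply: eW; rewrite iso.
Qed.

Lemma distMatrix_eq (R : realType) (r s : distMatrix R) :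
  (forall i j, r i j = s i j) -> r = s.
Proof.
case: r s => [r r1 r2 r3] [s s1 s2 s3] /= rs.
have E : r = s by apply/funext => i; apply/funext => j; exact: rs.
by subst s; congr DistMatrix; exact: Prop_irrelevance.
Qed.

Lemma mm_iso_distr (R : realType) (B : polishMetricType R) (X Y : mmField B) :
  mm_iso X Y -> forall A : set (borel (augDistMatrix R B)), measurable A ->
    aug_dmat_distr X A = aug_dmat_distr Y A.
Proof.
move=> [phi [bij iso proj push]] A mA.
have mphi : measurable_fun setT (phi : borel X -> borel Y).
  by apply: continuous_borel_measurable; exact: isometry_continuous.
have mFA : measurable (@aug_dmat R B Y @^-1` A : set (borel {ptws nat -> Y})).
  by rewrite -[X in measurable X]setTI; exact: aug_dmat_measurable.
apply: etrans (power_measure_pushforward mphi push mFA).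
rewrite /aug_dmat_distr /distribution /pushforward; congr (power_measure _ _).
apply/seteqP; suff E x : aug_dmat (fun i => phi (x i)) = aug_dmat (x : {ptws nat -> X}).
  by split => x /=; rewrite E.
congr pair; first by apply: distMatrix_eq => i j; exact: iso.
by apply/funext => i; exact: proj.
Qed.

(** * A weak law of large numbers *)

Section lln.
Variable R : realType.

Lemma integrable_of_bounded d (T : measurableType d) (P : probability T R)
    (f : T -> R) M :
  measurable_fun setT f -> (forall x, `|f x| <= M) -> P.-integrable setT (EFin \o f).
Proof.
move=> mf fM; apply: measurable_bounded_integrable => //.
  exact: le_lt_trans (probability_le1 _ _) (ltry _).
by exists M; split => [|N MN x _]; [exact: num_real|apply: le_trans (ltW MN)].
Qed.

(** Chebyshev's inequality, before division by the square of [e]. *)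
Lemma probability_ge_sqr d (T : measurableType d) (P : probability T R)
    (Z : T -> R) (e : R) :
  measurable_fun setT Z -> 0 <= e ->
  ((e ^+ 2)%:E * P [set x | (e <= `|Z x|)%R] <= \int[P]_x (Z x ^+ 2)%:E)%E.
Proof.
move=> mZ e0.
have mA : measurable [set x | e <= `|Z x|].
  rewrite (_ : [set x | _] = (fun x => `|Z x|) @^-1` `[e, +oo[%classic).
    rewrite -[X in measurable X]setTI.
    by apply: (measurableT_comp (@normr_measurable R setT) mZ).
  by apply/seteqP; split => x /=; rewrite in_itv/= andbT.
have mZ2 : measurable_fun setT (fun x => (Z x ^+ 2)%:E).
  by apply/measurable_EFinP; exact: measurable_funX.
rewrite -integral_cst//.
apply: (@le_trans _ _ (\int[P]_(x in [set x | (e <= `|Z x|)%R]) (Z x ^+ 2)%:E)%E).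
  apply: ge0_le_integral => //.
  - by move=> x _; rewrite lee_fin sqr_ge0.
  - exact: measurable_funTS.
  - by move=> x /= eZ; rewrite lee_fin -(real_normK (num_real (Z x))) ler_pXn2r.
by apply: ge0_subset_integral => // x _; rewrite lee_fin sqr_ge0.
Qed.

Variables (X : polishMetricType R) (mu : probability (borel X) R).
Local Notation P := (power_measure mu).

Lemma measurable_pair_coord i j : measurable_fun setT
  ((fun x => (x i, x j)) : borel {ptws nat -> X} -> (borel X * borel X)%type).
Proof. by apply/measurable_fun_pairP; split; exact: coord_measurable. Qed.

Lemma power_measure_pair i j (D : set (borel X * borel X)) : i != j -> measurable D ->
  P [set x | D (x i, x j)] = (mu \x mu)%E D.
Proof.
move=> ij mD.
apply/esym; apply: (@product_measure_unique _ _ _ _ R mu mu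
  (distribution P (mfun_of (@measurable_pair_coord i j)))) => // A B mA mB.
pose C k : set (borel X) := if k == i then A else if k == j then B else setT.
have mC k : measurable (C k) by rewrite /C; case: ifP => // _; case: ifP.
have iN : (i < maxn i.+1 j.+1)%N by rewrite leq_max ltnSn.
have jN : (j < maxn i.+1 j.+1)%N by rewrite leq_max ltnSn orbT.
have := @power_measureP _ _ mu (maxn i.+1 j.+1) C mC.
rewrite (bigD1 (Ordinal iN))//= (bigD1 (Ordinal jN))/=; last first.
  by rewrite -val_eqE /= eq_sym.
rewrite big1 ?mule1; last first.
  move=> k /andP[]; rewrite -!val_eqE /= /C => /negPf-> /negPf->.
  exact: probability_setT.
rewrite /C !eqxx (eq_sym j) (negPf ij) => <-.
rewrite /distribution /pushforward; congr (P _).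
apply/seteqP; split => [x [/= Ai Bj] k _|x /= Cx].
  by case: eqP => [->//|_]; case: eqP => [->|].
split; first by have := Cx i iN; rewrite eqxx.
by have := Cx j jN; rewrite eqxx (eq_sym j) (negPf ij).
Qed.

(** The pair of coordinates has law [mu \x mu], and by Fubini the integral of
[g x * g y] vanishes. *)
Lemma coord_uncorrelated (g : borel X -> R) i j : i != j ->
  measurable_fun setT g -> (forall x, `|g x| <= 1) ->
  (\int[mu]_x (g x)%:E = 0)%E -> (\int[P]_x (g (x i) * g (x j))%:E = 0)%E.
Proof.
move=> ij mg g1 g0.
pose h (z : borel X * borel X) := g z.1 * g z.2.
have mh : measurable_fun setT h.
  by apply: measurable_funM; apply: (measurableT_comp mg).
have h1 z : `|h z| <= 1 by rewrite normrM mulr_ile1.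
have mp := @measurable_pair_coord i j.
transitivity (\int[distribution P (mfun_of mp)]_z (h z)%:E)%E.
  rewrite integral_distribution//; first exact/measurable_EFinP.
  apply: (@integrable_of_bounded _ _ P (fun x => h (x i, x j)) 1) => //.
  exact: measurableT_comp mh mp.
rewrite (eq_measure_integral (mu \x mu)%E); last first.
  by move=> A mA _; exact: power_measure_pair.
rewrite -integral12_prod_meas1; last first.
  exact: (@integrable_of_bounded _ _ (mu \x mu)%E h 1).
apply: integral0_eq => x _; rewrite /fubini_F /h /=.
under eq_integral do rewrite EFinM.
rewrite integralZl// ?g0 ?mule0//.
exact: integrable_of_bounded mg g1.
Qed.

(** Off-diagonal terms of the squared sum have integral 0, and each of the [N]
diagonal ones is at most 1. *)
Lemma power_measure_sum_sqr (g : borel X -> R) N :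
  measurable_fun setT g -> (forall x, `|g x| <= 1) ->
  (\int[mu]_x (g x)%:E = 0)%E ->
  (\int[P]_x ((\sum_(i < N) g (x i)) ^+ 2)%:E <= N%:R%:E)%E.
Proof.
move=> mg g1 g0.
have mgi i : measurable_fun setT ((fun x => g (x i)) : borel {ptws nat -> X} -> R).
  exact: measurableT_comp mg (@coord_measurable R X i).
have ig i j : P.-integrable setT (fun x : borel {ptws nat -> X} => (g (x i) * g (x j))%:E).
  apply: (@integrable_of_bounded _ _ P (fun x => g (x i) * g (x j)) 1).
    exact: measurable_funM.
  by move=> x; rewrite normrM mulr_ile1.
under eq_integral => x _.
  rewrite expr2 big_distrl/=.
  under eq_bigr do rewrite big_distrr/=.
  rewrite pair_big/= -sumEFin.
  over.
rewrite integral_sum//= -(pair_big xpredT xpredT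
  (fun i j : 'I_N => (\int[P]_x (g (x i) * g (x j))%:E)%E))/=.
rewrite (_ : N%:R%:E = \sum_(i < N) 1%E); last first.
  by rewrite sumEFin sumr_const card_ord.
apply: lee_sum => i _; rewrite (bigD1 i)//= big1 ?adde0; last first.
  by move=> j ji; apply: coord_uncorrelated; rewrite // eq_sym.
apply: (@le_trans _ _ (\int[P]_x (cst 1 x))%E); last first.
  by rewrite integral_cst// mul1e probability_le1.
apply: ge0_le_integral => //.
- by move=> x _; rewrite lee_fin -expr2 sqr_ge0.
- by apply/measurable_EFinP; exact: measurable_funM.
- by move=> x _; rewrite lee_fin (le_trans (ler_norm _))// normrM mulr_ile1.
Qed.

Lemma weak_law (f : borel X -> R) N (e : R) : measurable_fun setT f ->
  (forall x, 0 <= f x <= 1) -> (0 < N)%N -> 0 < e ->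
  (P [set x : nat -> X | (e <= `|(\sum_(i < N) f (x i)) / N%:R - \int[mu]_x f x|)%R] <=
    ((N%:R * e ^+ 2)^-1)%R%:E)%E.
Proof.
move=> mf f01 N0 e0; set m := (\int[mu]_x f x).
have iF : mu.-integrable setT (EFin \o f).
  apply: (@integrable_of_bounded _ _ mu f 1) => // x.
  by rewrite ger0_norm; have /andP[] := f01 x.
have mE : (\int[mu]_x (f x)%:E = m%:E)%E.
  by rewrite /m /Rintegral fineK//; exact: integrable_fin_num.
have m01 : 0 <= m <= 1.
  rewrite -!lee_fin -mE; apply/andP; split.
    by apply: integral_ge0 => x _; rewrite lee_fin; have /andP[] := f01 x.
  apply: (@le_trans _ _ (\int[mu]_x (cst 1 x))%E); last first.
    by rewrite integral_cst// mul1e probability_le1.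
  apply: ge0_le_integral => //.
  - by move=> x _; rewrite lee_fin; have /andP[] := f01 x.
  - exact/measurable_EFinP.
  - by move=> x _; rewrite lee_fin; have /andP[] := f01 x.
pose g x := f x - m.
have mg : measurable_fun setT (g : borel X -> R) by exact: measurable_funB.
have g1 x : `|g x| <= 1.
  by rewrite /g ler_norml; have := f01 x; lra.
have g0 : (\int[mu]_x (g x)%:E = 0)%E.
  rewrite /g; under eq_integral do rewrite EFinB.
  rewrite integralB//; last exact: finite_measure_integrable_cst.
  have -> : (\int[mu]_x m%:E = m%:E)%E.
    rewrite integral_cst// -[RHS]mule1; congr (_ * _)%E; exact: probability_setT.
  by rewrite mE subee.
have N0' : 0 < N%:R :> R by rewrite ltr0n.
pose Z (x : borel {ptws nat -> X}) := \sum_(i < N) g (x i).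
have mZ : measurable_fun setT Z.
  by apply: measurable_sum => i; exact: measurableT_comp mg (@coord_measurable R X i).
have ZE (x : borel {ptws nat -> X}) :
    e <= `|(\sum_(i < N) f (x i)) / N%:R - m| = (N%:R * e <= `|Z x|).
  rewrite (_ : _ - m = Z x / N%:R); last first.
    by rewrite /Z sumrB sumr_const card_ord -[m *+ N]mulr_natr mulrBl mulfK// gt_eqF.
  by rewrite normrM normfV (gtr0_norm N0') ler_pdivlMr// mulrC.
rewrite (_ : [set x | _] = [set x | N%:R * e <= `|Z x|]); last first.
  by apply/seteqP; split => x /=; rewrite ZE.
have Ne0 : 0 < (N%:R * e) ^+ 2 by rewrite exprn_gt0// mulr_gt0.
have := le_trans (@probability_ge_sqr _ _ P Z _ mZ (ltW (mulr_gt0 N0' e0)))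
  (power_measure_sum_sqr N mg g1 g0).
rewrite -lee_pdivlMl// => /le_trans; apply.
rewrite -EFinM lee_fin exprMn expr2 -mulrA invfM -mulrA (mulrC _ N%:R) mulrA.
by rewrite mulVf ?gt_eqF// mul1r.
Qed.

End lln.

(** * Tightness *)

Section tightness.
Variable R : realType.

Lemma measure_bigcap_setC_le d (T : measurableType d) (P : probability T R)
    (F : nat -> set T) (e : R) : 0 <= e -> (forall k, measurable (F k)) ->
  (forall k, (P (~` F k) <= (e / (2 ^ k.+1)%:R)%:E)%E) ->
  (P (~` \bigcap_k F k) <= e%:E)%E.
Proof.
move=> e0 mF Fe; rewrite setC_bigcap.
apply: le_trans (epsilon_trick0 xpredT e0).
apply: (@le_trans _ _ (\sum_(k <oo) P (~` F k))%E).
  apply: measure_sigma_subadditive => //.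
    by move=> k; exact: measurableC.
  by apply: bigcup_measurable => k _; exact: measurableC.
exact: lee_nneseries.
Qed.

Variables (X : polishMetricType R).

Variable mu : probability (borel X) R.

(** A closed totally bounded set is compact: an ultrafilter on it contains a
ball of every radius, hence is Cauchy. *)
Lemma compact_of_small_balls (K : set X) (a : nat -> X) (M : nat -> nat) :
  closed K ->
  (forall m x, K x -> exists2 n, (n < M m)%N & mdist (a n) x <= m.+1%:R^-1) ->
  compact K.
Proof.
move=> cK Kball; rewrite compact_ultra => F FU FK.
have cF : cauchy_ex F.
  move=> e e0.
  have [m me] := exists_invS_lt e0.
  have : F (\bigcup_(n < M m) [set x | mdist (a n) x <= m.+1%:R^-1]).
    by apply: filterS FK => x /(Kball m) [n nM ax]; exists n.
  elim: (M m) => [|N IH].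
    by rewrite bigcup_mkord big_ord0 => /(@filter_not_empty _ F).
  move=> FU'.
  have [FN|FN] := in_ultra_setVsetC [set x | mdist (a N) x <= m.+1%:R^-1] FU.
    exists (a N); apply: filterS FN => x /= ax; rewrite ballEmdist.
    exact: le_lt_trans me.
  apply: IH; apply: filterS (filterI FU' FN) => x [[n nN nx] nNx].
  move: nN; rewrite /= ltnS leq_eqVlt => /predU1P[nN|nN]; last by exists n.
  by exfalso; apply: nNx; rewrite /= -nN.
have [l Fl] : exists l : X, F --> l.
  by apply/cvg_ex; apply: cauchy_cvg; exact: cauchy_exP.
exists l; split => //.
apply: cK => W /Fl FW; exact: filter_ex (filterI FK FW).
Qed.

(** Ulam's theorem: for each radius, finitely many balls cover all but a small
part of the space, and the intersection over the radii of these finite unions is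
totally bounded. *)
Lemma probability_tight (e : R) : 0 < e ->
  exists K : set X, [/\ compact K, closed K & (mu (~` K) <= e%:E)%E].
Proof.
move=> e0; have [a adense] := exists_dense_seq X.
pose U m M := \bigcup_(n < M) [set x | mdist (a n) x <= m.+1%:R^-1].
have cU m M : closed (U m M).
  rewrite /U bigcup_mkord; apply: closed_bigsetU => n _; exact: closed_mball.
have UM m : exists M, (mu (~` U m M) <= (e / (2 ^ m.+1)%:R)%:E)%E.
  have mU M : measurable (~` U m M : set (borel X)).
    by apply: measurableC; exact: closed_borel.
  have : mu (~` U m M) @[M --> \oo] --> (0 : \bar R).
    have I0 : \bigcap_M ~` U m M = set0.
      apply/seteqP; split => // x Ux.
      have [n nx] := adense x m.+1%:R^-1 (ltac:(by rewrite invr_gt0)).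
      apply: (Ux n.+1 I); exists n => //=.
      by rewrite metric_sym; exact: ltW.
    rewrite -(measure0 mu) -I0; apply: nonincreasing_cvg_mu => //.
    - exact: le_lt_trans (probability_le1 _ _) (ltry _).
    - by rewrite I0.
    - move=> i j ij; apply/subsetPset; apply: subsetC => x [n ni nx].
      by exists n => //; exact: leq_trans ij.
  move=> /fine_cvgP[_ /cvgrPdist_lt]/(_ (e / (2 ^ m.+1)%:R)).
  have d0 : 0 < e / (2 ^ m.+1)%:R by rewrite divr_gt0// ltr0n expn_gt0.
  move=> /(_ d0) [M _ /(_ M (leqnn M))] /=; rewrite sub0r normrN => H.
  exists M; rewrite -[leLHS]fineK ?lee_fin; last exact: fin_num_measure.
  exact: le_trans (ler_norm _) (ltW H).
have [M HM] := choice UM.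
exists (\bigcap_m U m (M m)); split.
  apply: (@compact_of_small_balls _ a M).
    by apply: closed_bigI => m _; exact: cU.
  by move=> m x /(_ m I) [n nM xn]; exists n.
  by apply: closed_bigI => m _; exact: cU.
apply: measure_bigcap_setC_le; first exact: ltW.
  by move=> m; exact: closed_borel.
exact: HM.
Qed.

Lemma power_measure_coord i (A : set (borel X)) : measurable A ->
  power_measure mu [set x : nat -> X | A (x i)] = mu A.
Proof.
move=> mA.
pose C k : set (borel X) := if k == i then A else setT.
have mC k : measurable (C k) by rewrite /C; case: ifP.
have := @power_measureP _ _ mu i.+1 C mC.
rewrite (bigD1 ord_max)//= big1 ?mule1; last first.
  move=> k; rewrite -!val_eqE /= /C => /negPf->; exact: probability_setT.
rewrite /C eqxx => <-; congr (power_measure mu _).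
apply/seteqP; split => [x Ai k _|x /(_ i (ltnSn i))] /=; last by rewrite eqxx.
by case: eqP => [->|].
Qed.

(** A product of compact sets, the i-th one missing mass at most
[e / 2 ^ i.+1]. *)
Lemma power_measure_tight (e : R) : 0 < e ->
  exists2 K : set {ptws nat -> X}, compact K &
    measurable (K : set (borel {ptws nat -> X})) /\
    (power_measure mu (~` K) <= e%:E)%E.
Proof.
move=> e0.
have d0 i : 0 < e / (2 ^ i.+1)%:R by rewrite divr_gt0// ltr0n expn_gt0.
have [K HK] := choice (fun i => probability_tight (d0 i)).
have mK i : measurable ([set x : nat -> X | K i (x i)] : set (borel {ptws nat -> X})).
  rewrite -[X in measurable X]setTI; apply: (@coord_measurable R X i) => //.
  by apply: closed_borel; case: (HK i).
have KE : [set x : {ptws nat -> X} | forall i, K i (x i)] =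
    \bigcap_i [set x : nat -> X | K i (x i)].
  by apply/seteqP; split => x /= Kx i; [move=> _|]; exact: Kx.
exists [set x : {ptws nat -> X} | forall i, K i (x i)].
  by apply: (@tychonoff nat (fun=> X)) => i; case: (HK i).
rewrite KE; split; first exact: bigcapT_measurable.
apply: measure_bigcap_setC_le => //; first exact: ltW.
move=> i; rewrite -[X in power_measure mu X]/[set x : nat -> X | (~` K i) (x i)].
rewrite power_measure_coord; first by case: (HK i).
by apply: measurableC; apply: closed_borel; case: (HK i).
Qed.

End tightness.

(** * Sequences with a common distance matrix *)

Section hausdorff.

Lemma cluster_continuous_eq (T U : topologicalType) (f : T -> U) (p q : T) :
  continuous f -> hausdorff_space U -> cluster (nbhs p) q -> f p = f q.
Proof.
move=> cf hU pq; apply: hU => A B /cf pA /cf qB.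
by have [z [Az Bz]] := pq _ _ pA qB; exists (f z).
Qed.

Variables (R : realType).

Lemma dmat_continuous i j : continuous (fun r : distMatrix R => r i j).
Proof.
pose n := (maxn i j).+1.
have ni : (i < n)%N by rewrite ltnS leq_maxl.
have nj : (j < n)%N by rewrite ltnS leq_maxr.
have cn : continuous (@nwblock R n).
  move=> r; have /cvg_sup/(_ n) H := @cvg_refl _ (nbhs r).
  apply: cvg_trans; last exact: (@initial_continuous _ _ (@nwblock R n) r).
  by move=> A /= /H.
rewrite (_ : (fun r => _) = (fun M : 'M[R]_n => M (Ordinal ni) (Ordinal nj)) \o @nwblock R n).
  by move=> r; apply: continuous_comp; [exact: cn|exact: coord_continuous].
by apply/funext => r; rewrite /= mxE.
Qed.

Lemma augDistMatrix_hausdorff (B : polishMetricType R) :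
  hausdorff_space (augDistMatrix R B).
Proof.
move=> [r l] [s m] rs.
have cr i j : continuous (fun z : augDistMatrix R B => z.1 i j).
  move=> z; apply: (@continuous_comp _ _ _ fst (fun r : distMatrix R => r i j)).
    exact: cvg_fst.
  exact: dmat_continuous.
have cl i : continuous (fun z : augDistMatrix R B => z.2 i).
  move=> z; apply: (@continuous_comp _ _ _ snd (fun l : {ptws nat -> B} => l i)).
    exact: cvg_snd.
  exact: ptws_coord_continuous.
congr pair.
  apply: distMatrix_eq => i j.
  exact: cluster_continuous_eq (cr i j) (@Rhausdorff R) rs.
apply/funext => i.
exact: cluster_continuous_eq (cl i) (@metric_hausdorff R B) rs.
Qed.

(** Images of compact sets are compact, hence Borel as the space of augmented
matrices is Hausdorff; both images have probability more than 1/2 for the common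
distribution, so they meet. *)
Lemma common_aug_dmat (B : polishMetricType R) (X Y : mmField B)
    (G : set {ptws nat -> X}) (H : set {ptws nat -> Y}) :
  (forall A : set (borel (augDistMatrix R B)), measurable A ->
    aug_dmat_distr X A = aug_dmat_distr Y A) ->
  compact G -> compact H ->
  measurable (G : set (borel {ptws nat -> X})) ->
  measurable (H : set (borel {ptws nat -> Y})) ->
  (power_measure (mm_measure X) (~` G) < 2^-1%:E)%E ->
  (power_measure (mm_measure Y) (~` H) < 2^-1%:E)%E ->
  exists x y, [/\ G x, H y & aug_dmat x = aug_dmat y].
Proof.
move=> XY cG cH mG mH PG PH; apply: contrapT => noxy.
have closed_image (Z : mmField B) (K : set {ptws nat -> Z}) : compact K ->
    measurable (@aug_dmat R B Z @` K : set (borel (augDistMatrix R B))).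
  move=> cK; apply: closed_borel; apply: compact_closed.
    exact: augDistMatrix_hausdorff.
  apply: continuous_compact cK; apply: continuous_subspaceT.
  exact: aug_dmat_continuous.
have distrC (Z : mmField B) (K : set {ptws nat -> Z}) : compact K ->
    measurable (K : set (borel {ptws nat -> Z})) ->
    (power_measure (mm_measure Z) (~` K) < 2^-1%:E)%E ->
    (aug_dmat_distr Z (~` (@aug_dmat R B Z @` K)) < 2^-1%:E)%E.
  move=> cK mK PK; apply: le_lt_trans PK.
  rewrite -[leLHS]/(power_measure (mm_measure Z)
    (@aug_dmat R B Z @^-1` (~` (@aug_dmat R B Z @` K)))).
  apply: le_measure; rewrite ?inE.
  - rewrite -[X in measurable X]setTI; apply: aug_dmat_measurable => //.
    by apply: measurableC; exact: closed_image.
  - exact: measurableC.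
  - by move=> z nKz Kz; apply: nKz; exists z.
have DG := distrC X G cG mG PG.
have := distrC Y H cH mH PH.
rewrite -XY; last by apply: measurableC; exact: closed_image.
move=> DH; have := lteD DG DH; 
rewrite -EFinD (_ : 2^-1 + 2^-1 = 1 :> R); last by lra.
move=> D1.
have : (1 <= aug_dmat_distr X (~` (@aug_dmat R B X @` G)) +
     aug_dmat_distr X (~` (@aug_dmat R B Y @` H)))%E.
  rewrite -[leLHS](probability_setT (aug_dmat_distr X)).
  rewrite (_ : setT = ~` (@aug_dmat R B X @` G) `|` ~` (@aug_dmat R B Y @` H)).
    by apply: measureU2; apply: measurableC; exact: closed_image.
  rewrite -setCI -setC0; congr (~` _); apply/esym/seteqP.
  split => // z [[x Gx xz] [y Hy yz]].
  by apply: noxy; exists x, y; split => //; rewrite xz.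
by rewrite leNgt D1.
Qed.

End hausdorff.

(** * Tent functions *)

Section ramp.
Variable R : realType.

Definition ramp (t : nat) (r : R) : R := Num.max 0 (Num.min 1 (t%:R * r)).

Lemma ramp01 t r : 0 <= ramp t r <= 1.
Proof. by rewrite le_max lexx /= ge_max ler01 ge_min lexx. Qed.

Lemma norm_min_le (a b u v e : R) : `|a - b| <= e -> `|u - v| <= e ->
  `|Num.min a u - Num.min b v| <= e.
Proof.
rewrite !ler_norml => /andP[? ?] /andP[? ?].
by case: (leP a u) => ?; case: (leP b v) => ?; apply/andP; split; lra.
Qed.

Lemma norm_max_le (a b u v e : R) : `|a - b| <= e -> `|u - v| <= e ->
  `|Num.max a u - Num.max b v| <= e.
Proof.
rewrite !ler_norml => /andP[? ?] /andP[? ?].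
by case: (leP a u) => ?; case: (leP b v) => ?; apply/andP; split; lra.
Qed.

Lemma ramp_lip t (r s e : R) : `|r - s| <= e -> `|ramp t r - ramp t s| <= t%:R * e.
Proof.
move=> rs; have e0 : 0 <= t%:R * e by rewrite mulr_ge0// (le_trans _ rs).
apply: norm_max_le; first by rewrite subrr normr0.
apply: norm_min_le; first by rewrite subrr normr0.
by rewrite -mulrBr normrM ger0_norm// ler_wpM2l.
Qed.

Lemma ramp_npos t (r : R) : r <= 0 -> ramp t r = 0.
Proof.
move=> r0; apply/max_idPl; rewrite ge_min; apply/orP; right.
by rewrite mulr_ge0_le0.
Qed.

Lemma ramp_pos (r : R) : 0 < r -> \forall t \near \oo, ramp t r = 1.
Proof.
move=> r0; near=> t; rewrite /ramp.
suff tr : 1 <= t%:R * r by rewrite (min_idPl tr) (max_idPr ler01).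
rewrite -ler_pdivrMr// div1r; near: t; exact: nbhs_infty_ger.
Unshelve. all: by end_near. Qed.

End ramp.

Section tent.
Variable R : realType.

(** A list of pairs (index of a centre, radius) and a slope.  Rational radii
make the type countable. *)
Definition tent_code := (seq (nat * rat) * nat)%type.

(** A continuous approximation from below, increasing with the slope, of the
indicator of the intersection of the balls of the list. *)
Definition tent (X : polishMetricType R) (c : nat -> X) (p : tent_code) (z : X) : R :=
  foldr (fun iq v => Num.min (ramp p.2 (ratr iq.2 - mdist (c iq.1) z)) v) 1 p.1.

Lemma tent01 (X : polishMetricType R) (c : nat -> X) p z : 0 <= tent c p z <= 1.
Proof.
rewrite /tent; elim: p.1 => [|iq l IH] /=; first by rewrite ler01 lexx.
have := ramp01 p.2 (ratr iq.2 - mdist (c iq.1) z) => /andP[r0 r1].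
by move: IH => /andP[IH0 IH1]; rewrite le_min r0 IH0 /= ge_min r1.
Qed.

(** Tents depend on distances to the centres only, and do so in a Lipschitz
way.  Two spaces are allowed, so that [e = 0] says that tents are determined by
the distance matrix; with [X = Y], moving the centres or the point gives the
usual uniform and pointwise estimates. *)
Lemma tent_lip (X Y : polishMetricType R) (c : nat -> X) (c' : nat -> Y) p z z'
    (e : R) :
  0 <= e ->
  (forall iq, iq \in p.1 -> `|mdist (c iq.1) z - mdist (c' iq.1) z'| <= e) ->
  `|tent c p z - tent c' p z'| <= p.2%:R * e.
Proof.
move=> e0; rewrite /tent; elim: p.1 => [|iq l IH] H /=.
  by rewrite subrr normr0 mulr_ge0.
apply: norm_min_le; last by apply: IH => jq jl; apply: H; rewrite inE jl orbT.
apply: ramp_lip; rewrite opprD addrACA subrr add0r -opprD normrN.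
by apply: H; rewrite mem_head.
Qed.

Lemma tent_map (X : polishMetricType R) (c : nat -> X) (s : nat -> nat) l t :
  tent c ([seq (s iq.1, iq.2) | iq <- l], t) = tent (c \o s) (l, t).
Proof. by apply/funext => z; rewrite /tent /=; elim: l => //= iq l ->. Qed.

Lemma tent_continuous (X : polishMetricType R) (c : nat -> X) p : continuous (tent c p).
Proof.
move=> z; apply/cvgrPdist_le => e e0.
have d0 : 0 < e / (p.2.+1)%:R by rewrite divr_gt0.
near=> z'.
apply: (@le_trans _ _ (p.2%:R * (e / (p.2.+1)%:R))).
  apply: tent_lip => [|iq _]; first exact: ltW.
  rewrite (metric_sym _ z) (metric_sym _ z'); apply: le_trans (mdist_lip _ _ _) _.
  by apply: ltW; near: z'; exact: mdist_nbhs.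
rewrite mulrCA ler_piMr//; first exact: ltW.
by rewrite ler_pdivrMr ?ltr0n// mul1r ler_nat.
Unshelve. all: by end_near. Qed.

Lemma measurable_tent (X : polishMetricType R) (c : nat -> X) p :
  measurable_fun setT (tent c p : borel X -> R).
Proof.
apply: (measurability _ (RGenOpens.measurableE R)) => //.
move=> _ [_ [a [b ->] <-]]; rewrite setTI; apply: sub_sigma_algebra.
have /continuousP := @tent_continuous X c p; apply; exact: interval_open.
Qed.

Definition cell (X : polishMetricType R) (c : nat -> X) (l : seq (nat * rat)) : set X :=
  [set z | forall iq, iq \in l -> mdist (c iq.1) z < ratr iq.2].

Lemma tent_notin_cell (X : polishMetricType R) (c : nat -> X) l t z :
  ~ cell c l z -> tent c (l, t) z = 0.
Proof.
move=> nlz.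
have [iq il iqz] : exists2 iq, iq \in l & ratr iq.2 <= mdist (c iq.1) z.
  apply: contrapT => H; apply: nlz => iq il; rewrite ltNge; apply/negP => iqz.
  by apply: H; exists iq.
apply/eqP; rewrite eq_le (andP (tent01 c (l, t) z)).1 andbT.
rewrite /tent /=; elim: l il {nlz} => // jq l IH; rewrite inE => /predU1P[<-|il] /=.
  by rewrite ge_min ramp_npos ?lexx// subr_le0.
by rewrite ge_min IH ?orbT.
Qed.

Lemma tent_near_indic (X : polishMetricType R) (c : nat -> X) l z :
  \forall t \near \oo, tent c (l, t) z = \1_(cell c l) z.
Proof.
have [lz|nlz] := pselect (cell c l z).
  rewrite indicE mem_set//; elim: l lz => [|iq l IH] lz.
    by near=> t.
  have lz' : cell c l z by move=> jq jl; apply: lz; rewrite inE jl orbT.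
  have r0 : 0 < ratr iq.2 - mdist (c iq.1) z by rewrite subr_gt0 lz// mem_head.
  near=> t; rewrite /tent /=.
  have -> : ramp t (ratr iq.2 - mdist (c iq.1) z) = 1 by near: t; exact: ramp_pos.
  rewrite -[foldr _ _ _]/(tent c (l, t) z).
  have -> : tent c (l, t) z = 1 by near: t; exact: IH.
  by rewrite minxx.
by rewrite indicE memNset//; near=> t; exact: tent_notin_cell.
Unshelve. all: by end_near. Qed.

Lemma open_cell (X : polishMetricType R) (c : nat -> X) l : open (cell c l).
Proof.
elim: l => [|iq l IH].
  by rewrite (_ : cell c [::] = setT); [exact: openT|apply/seteqP; split].
rewrite (_ : cell c (iq :: l) = [set z | mdist (c iq.1) z < ratr iq.2] `&` cell c l).
  by apply: openI => //; exact: open_mball.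
apply/seteqP; split => [z lz|z [iqz lz] jq].
  by split; [apply: lz; rewrite mem_head|move=> jq jl; apply: lz; rewrite inE jl orbT].
by rewrite inE => /predU1P[->//|]; exact: lz.
Qed.

Lemma integral_tent_cvg (X : polishMetricType R) (mu : probability (borel X) R)
    (c : nat -> X) l :
  (fun t => (\int[mu]_z (tent c (l, t) z)%:E)%E) @ \oo --> mu (cell c l).
Proof.
have mcell : measurable (cell c l : set (borel X)).
  by apply: sub_sigma_algebra; exact: open_cell.
have [] := @dominated_convergence _ (borel X) R mu setT measurableT
  (fun t z => (tent c (l, t) z)%:E) (fun z => (\1_(cell c l) z)%:E) (cst 1%E).
- by move=> t; apply/measurable_EFinP; exact: measurable_tent.
- by apply/measurable_EFinP; exact: measurable_indic.
- apply: aeW => z _; apply: cvg_near_cst.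
  by apply: filterS (tent_near_indic c l z) => t ->.
- exact: (finite_measure_integrable_cst mu 1%R).
- apply: aeW => z t _; have /andP[b0 b1] := tent01 c (l, t) z.
  by rewrite /= ger0_norm// lee_fin.
move=> _ _; rewrite integral_indic// setIT; exact.
Qed.

Lemma integrable_tent (X : polishMetricType R) (mu : probability (borel X) R) c p :
  mu.-integrable setT (EFin \o (tent c p : borel X -> R)).
Proof.
apply: (@integrable_of_bounded _ _ _ mu _ 1); first exact: measurable_tent.
by move=> x; have /andP[b0 b1] := tent01 c p x; rewrite ger0_norm.
Qed.

End tent.

(** * Typical and equidistributed sequences *)

Section generic.
Variables (R : realType) (X : polishMetricType R) (mu : probability (borel X) R).
Implicit Types (f g : X -> R) (x : nat -> X).

Definition emp_mean x N f : R := (\sum_(i < N) f (x i)) / N%:R.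

(** With this size and precision [1 / k.+1], the law of large numbers for
[k.+1] functions at once fails with probability at most [2 ^- k.+3], which is
summable.  It does not depend on the space. *)
Definition sample_size (k : nat) : nat := (k.+1 ^ 3 * 2 ^ k.+3)%N.

Lemma sample_size_gt0 k : (0 < sample_size k)%N.
Proof. by rewrite muln_gt0 !expn_gt0. Qed.

Lemma emp_mean_continuous N f : continuous f ->
  continuous ((fun x => emp_mean x N f) : {ptws nat -> X} -> R).
Proof.
move=> cf; have cS n : continuous (fun x : {ptws nat -> X} => \sum_(i < n) f (x i) : R).
  elim: n => [|n IH].
    rewrite (_ : (fun _ => _) = cst (0 : R)); first exact: cst_continuous.
    by apply/funext => x; rewrite big_ord0.
  rewrite (_ : (fun _ => _) = (fun x => \sum_(i < n) f (x i) + f (x n))); last first.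
    by apply/funext => x; rewrite big_ord_recr.
  move=> x.
  have cn : (fun y : {ptws nat -> X} => f (y n)) @ x --> f (x n).
    apply: (@continuous_comp _ _ _ (fun x : {ptws nat -> X} => x n) f).
      exact: ptws_coord_continuous.
    exact: cf.
  exact: (@cvgD R R^o _ (nbhs x) _ _ _ _ _ (IH x) cn).
move=> x; exact: (@cvgM R _ (nbhs x) _ _ _ _ _ (cS N x) (cvg_cst _)).
Qed.

Lemma emp_dev_continuous N f (m : R) : continuous f ->
  continuous ((fun x => `|emp_mean x N f - m|) : {ptws nat -> X} -> R).
Proof.
move=> cf x.
have H : ((fun y : {ptws nat -> X} => emp_mean y N f - m) @ x --> emp_mean x N f - m).
  exact: (@cvgB R R^o {ptws nat -> X} (nbhs x) _ (fun y => emp_mean y N f)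
    (fun=> m) _ _ (@emp_mean_continuous N f cf x) (cvg_cst m)).
exact: (@cvg_norm R R^o _ _ _ _ _ H).
Qed.

Lemma closed_dev N f (m : R) (D : set R) : continuous f -> closed D ->
  closed [set x : {ptws nat -> X} | D `|emp_mean x N f - m|].
Proof.
move=> cf cD.
apply: (@closed_comp {ptws nat -> X} R (fun x => `|emp_mean x N f - m|) D) => //.
by move=> x _; exact: emp_dev_continuous.
Qed.

Lemma emp_mean_lip x N f g (e : R) : 0 <= e ->
  (forall z, `|f z - g z| <= e) -> `|emp_mean x N f - emp_mean x N g| <= e.
Proof.
move=> e0 fg; rewrite /emp_mean -mulrBl -sumrB normrM normfV.
have [->|N0] := posnP N; first by rewrite big_ord0 normr0 mul0r.
rewrite (ger0_norm (ler0n _ N)) ler_pdivrMr ?ltr0n//.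
apply: le_trans (ler_norm_sum _ _ _) _.
apply: (@le_trans _ _ (\sum_(i < N) e)); first by apply: ler_sum => i _.
by rewrite sumr_const card_ord mulr_natr.
Qed.

Lemma Rintegral_lip (f g : borel X -> R) (e : R) :
  mu.-integrable setT (EFin \o f) -> mu.-integrable setT (EFin \o g) ->
  (forall z, `|f z - g z| <= e) -> `|\int[mu]_z f z - \int[mu]_z g z| <= e.
Proof.
move=> mf mg fg; rewrite -RintegralB//.
have ifg : mu.-integrable setT (EFin \o (fun z => f z - g z)).
  by rewrite (_ : _ \o _ = ((EFin \o f) \- (EFin \o g))%E); [exact: integrableB|].
apply: le_trans (le_normr_Rintegral _ ifg) _ => //.
apply: le_trans (@le_Rintegral _ _ _ mu setT _ (cst e) measurableT _ _ _) _.
- exact: integrable_norm.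
- exact: finite_measure_integrable_cst.
- by move=> z _; exact: fg.
- by rewrite Rintegral_cst// -[leRHS]mulr1 -[X in _ <= _ * X]/(fine 1%E)
    -(probability_setT mu).
Qed.

Variable (F : nat -> X -> R).
Hypothesis Fc : forall j, continuous (F j).
Hypothesis Fm : forall j, measurable_fun setT (F j : borel X -> R).
Hypothesis F01 : forall j z, 0 <= F j z <= 1.

(** Only the first [k.+1] functions are tested at stage [k]; each function is
tested at all but finitely many stages, with precision tending to 0. *)
Definition typical_at k : set {ptws nat -> X} := [set x | forall j, (j <= k)%N ->
  `|emp_mean x (sample_size k) (F j) - \int[mu]_z F j z| <= k.+1%:R^-1].

Lemma closed_typical_at k : closed (typical_at k).
Proof.
pose A j := [set x : {ptws nat -> X} |
  `|emp_mean x (sample_size k) (F j) - \int[mu]_z F j z| <= k.+1%:R^-1].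
rewrite (_ : typical_at k = \bigcap_(j in [set j | (j <= k)%N]) A j); last first.
  by apply/seteqP; split => x Gx j /=; exact: Gx.
apply: closed_bigI => j _.
by apply: (@closed_dev _ _ _ [set r | r <= k.+1%:R^-1]) => //; exact: closed_le.
Qed.

Lemma typical_at_prob k :
  (power_measure mu (~` typical_at k) <= (2^-1 ^+ 2 / (2 ^ k.+1)%:R)%:E)%E.
Proof.
pose A j := [set x : nat -> X |
  k.+1%:R^-1 <= `|emp_mean x (sample_size k) (F j) - \int[mu]_z F j z|].
have mA j : measurable (A j : set (borel {ptws nat -> X})).
  apply: (@closed_borel {ptws nat -> X}).
  by apply: (@closed_dev _ _ _ [set r | k.+1%:R^-1 <= r]) => //; exact: closed_ge.
apply: (@le_trans _ _ (power_measure mu (\big[setU/set0]_(j < k.+1) A j))).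
  apply: le_measure; rewrite ?inE.
  - by apply: measurableC; apply: (@closed_borel {ptws nat -> X}); exact: closed_typical_at.
  - exact: bigsetU_measurable.
  move=> x nx; rewrite -bigcup_mkord; apply: contrapT => nAx; apply: nx => j jk.
  rewrite leNgt; apply/negP => xj; apply: nAx; exists j => //=; exact: ltW.
apply: (@le_trans _ _ (\sum_(j < k.+1) power_measure mu (A j))%E).
  apply: content_subadditive => //; exact: bigsetU_measurable.
have Aj j : (power_measure mu (A j) <=
    (((sample_size k)%:R * k.+1%:R^-1 ^+ 2)^-1)%:E)%E.
  apply: weak_law; [exact: Fm|exact: F01|exact: sample_size_gt0|].
  by rewrite invr_gt0.
apply: (@le_trans _ _ (\sum_(j < k.+1)
    (((sample_size k)%:R * k.+1%:R^-1 ^+ 2)^-1)%:E)%E); first exact: lee_sum.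
rewrite sumEFin sumr_const card_ord lee_fin -[_ *+ k.+1]mulr_natr /sample_size.
rewrite natrM !natrX (exprS 2 k.+2) (exprS 2 k.+1).
have k0 : (k.+1%:R : R) != 0 by rewrite pnatr_eq0.
have p0 : (2 : R) ^+ k.+1 != 0 by rewrite expf_neq0// pnatr_eq0.
rewrite le_eqVlt; apply/orP; left; apply/eqP.
move: (k.+1%:R : R) (2 ^+ k.+1 : R) k0 p0 => a b a0 b0.
by field; rewrite a0 b0.
Qed.

Definition typical : set {ptws nat -> X} := \bigcap_k typical_at k.

Lemma closed_typical : closed typical.
Proof. by apply: closed_bigI => k _; exact: closed_typical_at. Qed.

Lemma typical_prob : (power_measure mu (~` typical) <= (2^-1 ^+ 2)%:E)%E.
Proof.
apply: measure_bigcap_setC_le; first by rewrite sqr_ge0.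
  move=> k; apply: (@closed_borel {ptws nat -> X}); exact: closed_typical_at.
exact: typical_at_prob.
Qed.

Lemma typical_cvg x j : typical x ->
  (fun k => emp_mean x (sample_size k) (F j)) @ \oo --> \int[mu]_z F j z.
Proof.
move=> tx; apply/cvgrPdist_le => e e0; near=> k.
rewrite distrC; apply: le_trans (tx k I j _) _; first by near: k; exact: nbhs_infty_ge.
apply: ltW; near: k; exact: (near_infty_natSinv_lt (PosNum e0)).
Unshelve. all: by end_near. Qed.

End generic.

Section equidistribution.
Variables (R : realType) (X : polishMetricType R) (mu : probability (borel X) R).

(** All centres [c] are allowed, in particular the terms of [x] itself, which is
what makes the integrals functions of the distance matrix. *)
Definition equidistributed (x : nat -> X) := forall (c : nat -> X) (p : tent_code),
  (fun k => emp_mean x (sample_size k) (tent c p)) @ \oo --> \int[mu]_z tent c p z.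

Definition nth_tent_code (j : nat) : tent_code := odflt ([::], 0%N) (unpickle j).

(** Countably many tests are enough: centres may be replaced by nearby points
of a dense sequence, which changes the tents uniformly little. *)
Lemma typical_equidistributed (a : nat -> X) (x : nat -> X) :
  (forall z e, 0 < e -> exists n, mdist z (a n) < e) ->
  typical mu (fun j => tent a (nth_tent_code j)) x -> equidistributed x.
Proof.
move=> adense tx c [l t]; apply/cvgrPdist_le => e e0.
(* Tents of slope t move by at most t * d <= e / 3 when their centres move by d. *)
pose d := e / (3 * t.+1%:R).
have d0 : 0 < d by rewrite divr_gt0// mulr_gt0.
have td : t%:R * d <= e / 3.
  rewrite (_ : _ * d = e / 3 * (t%:R / t.+1%:R)); last by rewrite /d invfM; ring.
  by rewrite ler_piMr ?divr_ge0 ?(ltW e0)// ler_pdivrMr ?ltr0n// mul1r ler_nat.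
have [s sP] := choice (fun i => adense (c i) _ d0).
pose p : tent_code := ([seq (s iq.1, iq.2) | iq <- l], t).
have close_tent z : `|tent c (l, t) z - tent a p z| <= e / 3.
  rewrite tent_map; apply: le_trans td; apply: tent_lip => [|iq _]; first exact: ltW.
  by apply: le_trans (mdist_lip _ _ _) _; exact: ltW.
have pE : nth_tent_code (pickle p) = p by rewrite /nth_tent_code pickleK.
have := typical_cvg (j := pickle p) tx; rewrite pE => /cvgrPdist_le /(_ (e / 3)).
have e3 : 0 < e / 3 by rewrite divr_gt0.
move=> /(_ e3); apply: filterS => k Hk.
have H1 := Rintegral_lip (integrable_tent mu c (l, t)) (integrable_tent mu a p) close_tent.
have H2 := emp_mean_lip x (sample_size k) (ltW e3) close_tent.
move: Hk H1 H2; rewrite !ler_norml => /andP[? ?] /andP[? ?] /andP[? ?].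
by apply/andP; split; lra.
Qed.

(** The tents below the indicator of the cell vanish along [x], so they have
integral 0. *)
Lemma measure_cell_eq0 (c : nat -> X) l (x : nat -> X) :
  equidistributed x -> (forall i, ~ cell c l (x i)) -> mu (cell c l) = 0%E.
Proof.
move=> ex nx.
have I0 t : (\int[mu]_z (tent c (l, t) z)%:E = 0)%E.
  have := ex c (l, t); rewrite (_ : (fun k => _) = cst 0); last first.
    apply/funext => k; rewrite /emp_mean big1 ?mul0r// => i _.
    exact: tent_notin_cell.
  move=> H; have E : \int[mu]_z tent c (l, t) z = 0.
    exact: (@cvg_unique _ (@Rhausdorff R) _ _ _ _ H (cvg_cst 0)).
  move: (congr1 EFin E).
  by rewrite /Rintegral fineK//; apply: integrable_fin_num => //; exact: integrable_tent.
apply: (@cvg_unique _ (@ereal_hausdorff R)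
  ((fun t => (\int[mu]_z (tent c (l, t) z)%:E)%E) @ \oo)).
  exact: integral_tent_cvg.
rewrite (_ : (fun t => _) = cst 0%E); first exact: cvg_cst.
by apply/funext => t; exact: I0.
Qed.

End equidistribution.

(** The empirical means of the tents centred at [x] and at [y] are equal, being
functions of the distance matrices; hence so are their integrals, and in the limit
of infinite slope the measures of the cells. *)
Lemma equidistributed_cell (R : realType) (X Y : polishMetricType R)
    (mu : probability (borel X) R) (nu : probability (borel Y) R) x y :
  equidistributed mu x -> equidistributed nu y ->
  (forall i j, mdist (x i) (x j) = mdist (y i) (y j)) ->
  forall l, mu (cell x l) = nu (cell y l).
Proof.
move=> ex ey xy l.
have intE p : (\int[mu]_z tent x p z = \int[nu]_z tent y p z).
  apply: (@cvg_unique _ (@Rhausdorff R) _ _ _ _ (ex x p)).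
  rewrite (_ : (fun k => _) = (fun k => emp_mean y (sample_size k) (tent y p))).
    exact: ey.
  apply/funext => k; congr (_ / _); apply: eq_bigr => i _.
  apply/eqP; rewrite -subr_eq0 -normr_le0 -(mulr0 p.2%:R); apply: tent_lip => // iq _.
  by rewrite xy subrr normr0.
have intEe p : (\int[mu]_z (tent x p z)%:E = \int[nu]_z (tent y p z)%:E)%E.
  move: (congr1 EFin (intE p)); rewrite /Rintegral.
  by rewrite !fineK//; apply: integrable_fin_num => //; exact: integrable_tent.
apply: (@cvg_unique _ (@ereal_hausdorff R)
  ((fun t => (\int[mu]_z (tent x (l, t) z)%:E)%E) @ \oo)).
  exact: integral_tent_cvg.
rewrite (_ : (fun t => _) = (fun t => (\int[nu]_z (tent y (l, t) z)%:E)%E)).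
  exact: integral_tent_cvg.
by apply/funext => t; exact: intEe.
Qed.

(** Otherwise [x] would miss a ball, which would then have measure 0, against
full support. *)
Lemma equidistributed_dense (R : realType) (X : polishMetricType R)
    (mu : probability (borel X) R) (x : nat -> X) :
  supp mu = setT -> equidistributed mu x ->
  forall z e, 0 < e -> exists i, mdist z (x i) < e.
Proof.
move=> suppT ex z e e0; apply: contrapT => nx.
have [q /andP[q0 qe]] : exists q : rat, 0 < (ratr q : R) < e.
  by have [q] := rat_in_itvoo e0; rewrite in_itv/=; exists q.
pose l : seq (nat * rat) := [:: (0%N, q)].
have zc : cell (fun=> z) l z by move=> iq; rewrite inE => /eqP ->; rewrite mdistxx.
have : supp mu z by rewrite suppT.
move=> /(_ _ (@open_cell _ _ (fun=> z) l) zc).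
rewrite (measure_cell_eq0 ex) ?ltxx// => i xi; apply: nx; exists i.
by apply: lt_trans qe; apply: (xi (0%N, q)); rewrite mem_head.
Qed.

(** * Reconstruction of the space *)

Section extension.
Variable R : realType.

(** The [y i] for which [x i] is close to [z] form a Cauchy filter; its limit is
the point sought. *)
Lemma exists_same_distances (X Y : polishMetricType R) (x : nat -> X)
    (y : nat -> Y) (z : X) :
  (forall i j, mdist (x i) (x j) = mdist (y i) (y j)) ->
  (forall e, 0 < e -> exists i, mdist z (x i) < e) ->
  exists w : Y, forall i, mdist w (y i) = mdist z (x i).
Proof.
move=> xy zx.
pose F : set_system Y := filter_from [set e : R | 0 < e]
  (fun e => [set y i | i in [set i | mdist z (x i) < e]]).
have FF : ProperFilter F.
  apply: filter_from_proper; last by move=> e /zx [i zi]; exists (y i); exists i.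
  apply: filter_from_filter; first by exists 1 => /=.
  move=> e f /= e0 f0; exists (Num.min e f); first by rewrite /= lt_min e0.
  by move=> _ [i /= + <-]; rewrite lt_min => /andP[? ?]; split; exists i.
have cF : cauchy F.
  apply: cauchy_exP => e e0; have [i zi] := zx (e / 2) (divr_gt0 e0 (ltr0Sn _ _)).
  exists (y i); exists (e / 2); first by rewrite /= divr_gt0.
  move=> _ [j /= zj <-]; rewrite ballEmdist /= -xy.
  by have := metric_triangle (x i) z (x j); rewrite (metric_sym (x i) z); lra.
have /cvg_ex[w Fw] : cvg F by exact: cauchy_cvg.
have near_w e : 0 < e -> exists j, mdist w (y j) < e /\ mdist z (x j) < e.
  move=> e0.
  have Fe : F [set y i | i in [set i | mdist z (x i) < e]] by exists e.
  have [v [wv [j zj jv]]] := filter_ex (filterI (Fw _ (mdist_nbhs w e0)) Fe).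
  by exists j; split => //; rewrite jv.
exists w => i; apply/eqP; rewrite eq_le; apply/andP; split; apply/ler_addgt0Pl => e e0;
  have [j [wj zj]] := near_w (e / 2) (divr_gt0 e0 (ltr0Sn _ _)).
- have := metric_triangle w (y j) (y i); have := metric_triangle (x j) z (x i).
  by rewrite -xy (metric_sym (x j) z); lra.
- have := metric_triangle z (x j) (x i); have := metric_triangle (y j) w (y i).
  by rewrite xy (metric_sym (y j) w); lra.
Qed.

Lemma dense_separates (Y : polishMetricType R) (y : nat -> Y) (w w' : Y) :
  (forall e, 0 < e -> exists i, mdist w (y i) < e) ->
  (forall i, mdist w (y i) = mdist w' (y i)) -> w = w'.
Proof.
move=> wy ww'; apply: mdist_positivity; apply/eqP; rewrite eq_le mdist_ge0 andbT.
apply/ler_addgt0Pl => e e0; have [i wi] := wy (e / 2) (divr_gt0 e0 (ltr0Sn _ _)).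
have := metric_triangle w (y i) w'; rewrite (metric_sym (y i) w') -ww'; lra.
Qed.

(** The extension is defined by the distances of its values to the dense
sequence; exchanging the roles of [X] and [Y] gives its inverse. *)
Lemma extend_isometry (X Y : polishMetricType R) (x : nat -> X) (y : nat -> Y) :
  (forall i j, mdist (x i) (x j) = mdist (y i) (y j)) ->
  (forall z e, 0 < e -> exists i, mdist z (x i) < e) ->
  (forall w e, 0 < e -> exists i, mdist w (y i) < e) ->
  exists phi : X -> Y, [/\ bijective phi,
    forall z z', mdist (phi z) (phi z') = mdist z z' &
    forall z i, mdist (phi z) (y i) = mdist z (x i)].
Proof.
move=> xy dx dy.
have [phi phiP] := choice (fun z => exists_same_distances xy (dx z)).
have [psi psiP] :=
  choice (fun w => exists_same_distances (fun i j => esym (xy i j)) (dy w)).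
exists phi; split => //.
  exists psi => [z|w].
    by apply: dense_separates (dx _) _ => i; rewrite psiP phiP.
  by apply: dense_separates (dy _) _ => i; rewrite phiP psiP.
move=> z z'; apply/eqP; rewrite eq_le; apply/andP; split; apply/ler_addgt0Pl => e e0;
  have [i zi] := dx z (e / 2) (divr_gt0 e0 (ltr0Sn _ _)).
- have := metric_triangle (phi z) (y i) (phi z'); have := metric_triangle (x i) z z'.
  rewrite (metric_sym (y i) (phi z')) !phiP.
  by rewrite (metric_sym (x i) z) (metric_sym (x i) z'); lra.
- have := metric_triangle z (x i) z'; have := metric_triangle (y i) (phi z) (phi z').
  rewrite (metric_sym (y i) (phi z)) (metric_sym (y i) (phi z')) !phiP.
  by rewrite (metric_sym (x i) z'); lra.
Qed.

Lemma open_cell_gen (Y : polishMetricType R) (y : nat -> Y) (W : set Y) :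
  (forall w e, 0 < e -> exists i, mdist w (y i) < e) -> open W ->
  <<s range (cell y) >> W.
Proof.
move=> dy oW.
pose nth_list n : seq (nat * rat) := odflt [::] (unpickle n).
rewrite (_ : W = \bigcup_(n in [set n | cell y (nth_list n) `<=` W]) cell y (nth_list n)).
  apply: (@bigcup_measurable _ (g_sigma_algebraType (range (cell y)))) => n _.
  by apply: sub_sigma_algebra; exists (nth_list n).
apply/seteqP; split => [w Ww|w [n /= nW nw]]; last exact: nW.
have [e e0 eW] := nbhs_mdist (open_nbhs_nbhs (conj oW Ww)).
have [i wi] := dy w (e / 3) (divr_gt0 e0 (ltr0Sn _ _)).
have e3 : e / 3 < e / 3 * 2 by lra.
have [q] := rat_in_itvoo e3; rewrite in_itv/= => /andP[q1 q2].
have lE : nth_list (pickle [:: (i, q)]) = [:: (i, q)] by rewrite /nth_list pickleK.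
exists (pickle [:: (i, q)]); rewrite /mkset lE.
  move=> w' /(_ (i, q)); rewrite mem_head => /(_ isT) /= iw'; apply: eW.
  have := metric_triangle w (y i) w'; lra.
by move=> iq; rewrite inE => /eqP -> /=; rewrite metric_sym; lra.
Qed.

End extension.

(** Equidistributed sequences with the same augmented matrix exist, and the
isometry they define is an isomorphism. *)
Lemma distr_mm_iso (R : realType) (B : polishMetricType R) (X Y : mmField B) :
  supp (mm_measure X) = setT -> supp (mm_measure Y) = setT ->
  (forall A : set (borel (augDistMatrix R B)), measurable A ->
    aug_dmat_distr X A = aug_dmat_distr Y A) -> mm_iso X Y.
Proof.
move=> suppX suppY XY.
have good (Z : mmField B) : exists G : set {ptws nat -> Z},
    [/\ compact G, measurable (G : set (borel {ptws nat -> Z})),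
      (power_measure (mm_measure Z) (~` G) < 2^-1%:E)%E &
      forall x, G x -> equidistributed (mm_measure Z) x].
  have [a adense] := exists_dense_seq Z.
  pose F j := tent a (nth_tent_code j).
  have Fc j : continuous (F j) by exact: tent_continuous.
  have Fm j : measurable_fun setT (F j : borel Z -> R) by exact: measurable_tent.
  have F01 j z : 0 <= F j z <= 1 by exact: tent01.
  have e8 : (0 : R) < 8^-1 by rewrite invr_gt0.
  have [K cK [mK PK]] := power_measure_tight (mm_measure Z) e8.
  have cT : closed (typical (mm_measure Z) F) by exact: closed_typical.
  have mT : measurable (typical (mm_measure Z) F : set (borel {ptws nat -> Z})).
    exact: (@closed_borel {ptws nat -> Z}).
  (* The complement has measure at most 1/8 + 1/4. *)
  exists (K `&` typical (mm_measure Z) F); split.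
  - exact: compact_closedI.
  - exact: measurableI.
  - rewrite setCI; apply: (@le_lt_trans _ _ (8^-1%:E + (2^-1 ^+ 2)%:E)%E).
      apply: le_trans; first by apply: measureU2; exact: measurableC.
      by apply: leeD => //; exact: typical_prob.
    by rewrite -EFinD lte_fin expr2; lra.
  - by move=> x [_ Tx]; exact: typical_equidistributed adense Tx.
have [G [cG mG PG eG]] := good X.
have [H [cH mH PH eH]] := good Y.
have [x [y [Gx Hy Exy]]] := common_aug_dmat XY cG cH mG mH PG PH.
have ex := eG _ Gx; have ey := eH _ Hy.
have xy i j : mdist (x i) (x j) = mdist (y i) (y j).
  by have := congr1 (fun z : augDistMatrix R B => z.1 i j) Exy.
have pxy i : mm_proj (x i) = mm_proj (y i).
  by have := congr1 (fun z : augDistMatrix R B => z.2 i) Exy.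
have dx := equidistributed_dense suppX ex.
have dy := equidistributed_dense suppY ey.
have [phi [bij iso phiy]] := extend_isometry xy dx dy.
exists phi; split => //.
  move=> z; apply: mdist_positivity; apply/eqP; rewrite eq_le mdist_ge0 andbT.
  apply/ler_addgt0Pl => e e0; have [i zi] := dx z (e / 2) (divr_gt0 e0 (ltr0Sn _ _)).
  have := metric_triangle (mm_proj (phi z)) (mm_proj (y i)) (mm_proj z).
  have := mm_proj_lip (phi z) (y i); have := mm_proj_lip (x i) z.
  by rewrite -pxy phiy (metric_sym (x i)); lra.
have mphi : measurable_fun setT (phi : borel X -> borel Y).
  by apply: continuous_borel_measurable; exact: isometry_continuous.
have phicell l : phi @^-1` cell y l = cell x l.
  by apply/seteqP; split => z lz iq /lz; rewrite /= (metric_sym _ (phi z)) phiy metric_sym.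
move=> A mA.
apply: (@g_sigma_algebra_measure_unique _ R (borel Y) (range (cell y)) _ (fun=> setT) _ _
  (distribution (mm_measure X) (mfun_of mphi)) (mm_measure Y)).
- by move=> _ [l _ <-]; apply: sub_sigma_algebra; exact: open_cell.
- by move=> i; exists [::] => //; apply/seteqP; split.
- by rewrite bigcup_const//; exists 0%N.
- move=> _ _ [l _ <-] [l' _ <-]; exists (l ++ l') => //.
  apply/seteqP; split => [z lz|z [lz lz'] iq].
    by split => iq il; apply: lz; rewrite mem_cat il ?orbT.
  by rewrite mem_cat => /orP[/lz|/lz'].
- move=> _ [l _ <-]; rewrite /distribution /pushforward.
  apply: etrans (equidistributed_cell ex ey xy l).
  by congr (mm_measure X _); exact: phicell.
- by move=> k; rewrite (le_lt_trans (probability_le1 _ _))// ltry.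
- move: A mA; apply: smallest_sub; first exact: smallest_sigma_algebra.
  by move=> W; exact: open_cell_gen.
Qed.

Theorem theorem6p3 (R : realType) (B : polishMetricType R) (X Y : mmField B)
    (suppX : supp (mm_measure X) = [set: X])
    (suppY : supp (mm_measure Y) = [set: Y]) :
  mm_iso X Y <->
  (forall A : set (borel (augDistMatrix R B)), measurable A ->
    aug_dmat_distr X A = aug_dmat_distr Y A).
Proof. by split; [exact: mm_iso_distr|exact: distr_mm_iso]. Qed.
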